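(* Let $m,n,d,e,k$ be positive integers with $m=2n$, $e=\gcd(n,d)=\gcd(m,d)$ and $1\le k\le \frac{n}{e}$, and let $C$ be the binary code described in the context. For even $r$ with $0\le r\le m/e$ and $\varepsilon\in\{1,-1\}$, let \[\alpha_{r,\varepsilon}=\#\{0\neq c\in C\mid {\rm DC}(c)=-1+\varepsilon 2^{m-\frac{er}{2}}\}.\] Then for each $j=0,1,\dots,k-1$ and each $\varepsilon=\pm1$, \[\alpha_{\frac{m}{e}-2j,\varepsilon}=\frac12\big(2^{m-2ej}+\varepsilon2^{\frac{m}{2}-ej}\big)\sum_{v=j}^{k-1}(-1)^{v-j}4^{e\binom{v-j}{2}}\binom{v}{j}_{4^e}\binom{\frac{m}{2e}}{v}_{4^e}\big(2^{n(2k-1-2v)+ev}-1\big).\]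
   Context: For $\vec a=(a_0,a_1,\dots,a_k)\in\mathbb{F}_{2^n}\times\mathbb{F}_{2^m}^k$ define $Q_{\vec a}:\mathbb{F}_{2^m}\to\mathbb{F}_{2^e}$ by \[Q_{\vec a}(x)={\rm Tr}_{\mathbb{F}_{2^n}/\mathbb{F}_{2^e}}\big(a_0x^{2^{nd/e}+1}\big)+\sum_{j=1}^{k-1}{\rm Tr}_{\mathbb{F}_{2^m}/\mathbb{F}_{2^e}}\big(a_jx^{2^{(\frac{n}{e}-j)d}+1}\big)+{\rm Tr}_{\mathbb{F}_{2^m}/\mathbb{F}_{2^e}}(a_kx).\] Here $x^{2^{nd/e}+1}\in\mathbb{F}_{2^n}$. Let $\pi$ be a primitive element of $\mathbb{F}_{2^m}$. Let $c_{\vec a}=(c_{\vec a,0},\dots,c_{\vec a,2^m-2})$ with $c_{\vec a,i}={\rm Tr}_{\mathbb{F}_{2^e}/\mathbb{F}_2}(Q_{\vec a}(\pi^{-i}))$, and let $C=\{c_{\vec a}\mid\vec a\in\mathbb{F}_{2^n}\times\mathbb{F}_{2^m}^k\}$. For $c=(c_0,\dots,c_{2^m-2})\in C$, ${\rm DC}(c)=\sum_{i=0}^{2^m-2}(-1)^{c_i}$. The symbol $\binom{a}{b}_q$ denotes the Gaussian binomial coefficient, and $\binom{a}{2}=a(a-1)/2$. *)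

(* Defs.v *)
From HB Require Import structures.
From mathcomp Require Import all_boot all_order all_algebra all_field.
Set Implicit Arguments. Unset Strict Implicit. Unset Printing Implicit Defensive.
Import GRing.Theory Num.Theory.
Local Open Scope ring_scope.

(* Frobenius-sum trace: for y in F_{2^(r t)}, this is Tr_{F_{2^(r t)}/F_{2^r}}(y)
   = sum_{i<t} y^(2^(r i)). *)
Definition frob_trace (L : fieldType) (r t : nat) (y : L) : L :=
  \sum_(i < t) y ^+ (2 ^ (r * i)).

Definition Qa (L : fieldType) (m n d e k : nat) (a : {ffun 'I_k.+1 -> L}) (x : L) : L :=
  frob_trace e (n %/ e) (a ord0 * x ^+ (2 ^ (n * (d %/ e)) + 1))
  + \sum_(1 <= j < k) frob_trace e (m %/ e) (a (inord j) * x ^+ (2 ^ ((n %/ e - j) * d) + 1))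
  + frob_trace e (m %/ e) (a (inord k) * x).

(* parameter set F_{2^n} x F_{2^m}^k inside L = F_{2^m} *)
Definition param_set (L : finFieldType) (n k : nat) : {set {ffun 'I_k.+1 -> L}} :=
  [set a : {ffun 'I_k.+1 -> L} | a ord0 ^+ (2 ^ n) == a ord0].

Definition codeword (L : finFieldType) (m n d e k : nat) (pi : L)
  (a : {ffun 'I_k.+1 -> L}) : {ffun 'I_(2 ^ m - 1) -> bool} :=
  [ffun i : 'I_(2 ^ m - 1) => frob_trace 1 e (Qa m n d e a (pi ^- i)) != 0].

Definition code (L : finFieldType) (m n d e k : nat) (pi : L)
  : {set {ffun 'I_(2 ^ m - 1) -> bool}} :=
  [set codeword m n d e pi a | a in param_set L n k].

Definition DC (N : nat) (c : {ffun 'I_N -> bool}) : int :=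
  \sum_(i < N) (-1) ^+ (c i : nat).

Definition alpha (L : finFieldType) (m n d e k : nat) (pi : L) (r : nat) (eps : int) : nat :=
  #|[set c in code m n d e k pi |
      (c != [ffun=> false]) && (DC c == -1 + eps * 2%:Z ^+ (m - (e * r) %/ 2))]|.

(* Gaussian binomial coefficient [a choose b]_q (= 0 when b > a) *)
Definition gbinom (q a b : nat) : rat :=
  \prod_(i < b) ((q%:R ^+ (a - i) - 1) / (q%:R ^+ i.+1 - 1)).

(* Main.v *)
(* Put q = 2^e, N = n / e and sigma x = x^(2^d). The traced form Q_a polarises to
   beta_a(x, z) = Tr (z * L_a x), where L_a is a combination of sigma^(N - k + 1), ...,
   sigma^(N + k - 1), alternating over the field K = F_q fixed by sigma; so the kernel
   of L_a has 1 <= q^(2 j) <= q^(2 (k - 1)) elements unless a_0 = ... = a_(k-1) = 0.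
   The exponential sum of Q_a vanishes or squares to 2^m |ker L_a|, and averaging it
   and its square over a_k gives, for each kernel size, the number of times it takes
   each of its two nonzero values.

   It remains to count the a with a kernel of given size. For u < k and K-independent
   x_1, ..., x_u the number of a with L_a x_1 = ... = L_a x_u = 0 does not depend on
   the x_i: by character sums this reduces to the fact that
   \sum_i (x_i sigma^h z_i + z_i sigma^h x_i), if it vanishes for 2u consecutive h,
   vanishes for all h. This determines the averages of \prod_(i < u) (|ker L_a| - q^i),
   hence those of \prod_(i < u) (|ker L_a| - q^(2i)), which are the q^2-binomial moments
   of j up to a factor; Gaussian inversion concludes. *)
Require Import Defs.
From HB Require Import structures.
From mathcomp Require Import all_boot all_order all_algebra all_field.
From mathcomp Require Import ring zify.
Set Implicit Arguments. Unset Strict Implicit. Unset Printing Implicit Defensive.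
Import Order.TTheory GRing.Theory Num.Theory.
Local Open Scope ring_scope.

(** * Frobenius powers and absolute traces in characteristic two *)

Definition fr (L : fieldType) (i : nat) (x : L) : L := x ^+ (2 ^ i).

Section Frobenius.
Variables (L : fieldType).
Hypothesis charL : 2%N \in [pchar L].
Implicit Types (x y z w : L).

Lemma frA i j x : fr i (fr j x) = fr (i + j) x.
Proof. by rewrite /fr -exprM -expnD addnC. Qed.

Lemma frM i x y : fr i (x * y) = fr i x * fr i y.
Proof. exact: exprMn. Qed.

Lemma fr0n x : fr 0 x = x. Proof. exact: expr1. Qed.

Lemma fr1 i : fr i (1 : L) = 1. Proof. exact: expr1n. Qed.

Lemma fr0 i : fr i (0 : L) = 0.
Proof. by rewrite /fr expr0n expn_eq0. Qed.

Lemma frD i x y : fr i (x + y) = fr i x + fr i y.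
Proof. by rewrite /fr exprDn_pchar // pnatX pnatE ?charL. Qed.

Lemma fr_sum i (I : Type) (r : seq I) (P : pred I) (F : I -> L) :
  fr i (\sum_(j <- r | P j) F j) = \sum_(j <- r | P j) fr i (F j).
Proof. exact: (big_morph (fr i) (frD i) (fr0 i)). Qed.

Lemma frV i x : fr i x^-1 = (fr i x)^-1.
Proof. exact: exprVn. Qed.

Lemma fr_eq0 i x : (fr i x == 0) = (x == 0).
Proof. by rewrite /fr expf_eq0 expn_gt0. Qed.

Lemma addrr2 x : x + x = 0. Proof. exact: addrr_pchar2. Qed.

Lemma addr_eq0_2 x y : (x + y == 0) = (x == y).
Proof. by rewrite addr_eq0 oppr_pchar2. Qed.

Lemma fr_inj i : injective (@fr L i).
Proof.
by move=> x y /eqP; rewrite -addr_eq0_2 -frD fr_eq0 addr_eq0_2 => /eqP.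
Qed.

Lemma frob_traceE r t y : frob_trace r t y = \sum_(i < t) fr (r * i) y.
Proof. by []. Qed.

Lemma frob_traceD r t x y :
  frob_trace r t (x + y) = frob_trace r t x + frob_trace r t y.
Proof. by rewrite !frob_traceE -big_split; apply: eq_bigr => i _; rewrite frD. Qed.

Lemma frob_trace0 r t : frob_trace r t (0 : L) = 0.
Proof. by rewrite frob_traceE big1 // => i _; rewrite fr0. Qed.

Lemma frob_trace_sum r t (I : Type) (s : seq I) (P : pred I) (F : I -> L) :
  frob_trace r t (\sum_(j <- s | P j) F j) =
  \sum_(j <- s | P j) frob_trace r t (F j).
Proof. exact: (big_morph _ (frob_traceD r t) (frob_trace0 r t)). Qed.

Lemma frob_trace_comp e t y :
  frob_trace 1 e (frob_trace e t y) = frob_trace 1 (e * t) y.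
Proof.
elim: t => [|t IH].
  by rewrite muln0 /frob_trace !big_ord0 -/(frob_trace 1 e 0) frob_trace0.
rewrite {2}/frob_trace big_ord_recr /= frob_traceD -/(frob_trace e t y) IH.
rewrite mulnS addnC !frob_traceE big_split_ord /=; congr (_ + _).
by apply: eq_bigr => i _; rewrite -/(fr (e * t) y) frA !mul1n addnC.
Qed.

(** When [fr (2 * n)] is the identity, [w + fr n w] is a relative trace, so this is transitivity; it
    merges the two conjugate cross terms of the [a_0] summand. *)
Lemma frob_trace_double n w :
  frob_trace 1 n (w + fr n w) = frob_trace 1 (2 * n) w.
Proof.
rewrite frob_traceD mul2n -addnn !frob_traceE big_split_ord /=; congr (_ + _).
by apply: eq_bigr => i _; rewrite frA !mul1n addnC.
Qed.

Lemma fr_frob_trace n y : fr n y = y ->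
  fr 1 (frob_trace 1 n y) = frob_trace 1 n y.
Proof.
case: n => [|n] yn; first by rewrite /frob_trace big_ord0 fr0.
rewrite frob_traceE fr_sum big_ord_recr big_ord_recl addrC /=.
rewrite frA mul1n muln0 fr0n addnC addn1 yn; congr (_ + _).
by apply: eq_bigr => i _; rewrite frA !mul1n add1n.
Qed.

Lemma frob_trace_fr n y i : fr n y = y ->
  frob_trace 1 n (fr i y) = frob_trace 1 n y.
Proof.
move=> yn; elim: i => [|i <-]; first by rewrite fr0n.
have yi : fr n (fr i y) = fr i y by rewrite frA addnC -frA yn.
rewrite -[RHS](fr_frob_trace yi) [in RHS]frob_traceE fr_sum.
by apply: eq_bigr => j _; rewrite -/(fr _ _) !frA; congr fr; lia.
Qed.

Lemma fr1_bool y : fr 1 y = y -> (y == 0) || (y == 1).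
Proof.
rewrite /fr expn1 expr2 => /eqP; rewrite -subr_eq0 -{3}[y]mulr1 -mulrBr.
by rewrite mulf_eq0 subr_eq0.
Qed.

Lemma frob_trace_bool n y : fr n y = y ->
  (frob_trace 1 n y == 0) || (frob_trace 1 n y == 1).
Proof. by move=> yn; apply/fr1_bool/fr_frob_trace. Qed.

End Frobenius.

(* The additive character of the prime field {0, 1} of [L]; only meaningful there,
   since every element other than [0] is sent to [-1]. *)
Definition psi (L : fieldType) (y : L) : int := (-1) ^+ (y != 0).

Section Psi.
Variables (L : fieldType).
Hypothesis charL : 2%N \in [pchar L].

Lemma psi0 : psi (0 : L) = 1. Proof. by rewrite /psi eqxx. Qed.

Lemma psi1 : psi (1 : L) = -1. Proof. by rewrite /psi oner_eq0. Qed.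

Lemma boolD (y z : L) : (y == 0) || (y == 1) -> (z == 0) || (z == 1) ->
  (y + z == 0) || (y + z == 1).
Proof.
by move=> /orP[] /eqP-> /orP[] /eqP->;
  rewrite ?add0r ?addr0 ?(addrr2 charL) // eqxx ?orbT.
Qed.

Lemma psiD (y z : L) : (y == 0) || (y == 1) -> (z == 0) || (z == 1) ->
  psi (y + z) = psi y * psi z.
Proof.
by case/orP=> /eqP-> /orP[] /eqP->;
  rewrite ?addr0 ?add0r ?(addrr2 charL) ?psi0 ?psi1.
Qed.

End Psi.

(** * Cancellation in character sums *)

Lemma sum_sign_reversing (I : finType) (G : pred I) (g : I -> int) (t : I -> I) :
  involutive t -> (forall x, G (t x) = G x) ->
  (forall x, G x -> g (t x) = - g x) -> \sum_(x | G x) g x = 0.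
Proof.
move=> tK tG tg.
have : \sum_(x | G x) g x = - \sum_(x | G x) g x.
  rewrite {1}(reindex_inj (inv_inj tK)) -sumrN /=.
  rewrite (eq_bigl G) //; exact: eq_bigr.
lia.
Qed.

(** Translation by an element where [g] is 1 reverses all signs. The operation [op] is abstract so
    that subsets of [L] and sets of coefficient vectors are both covered. *)
Lemma sum_psi_group (L : fieldType) (I : finType) (G : pred I) (op : I -> I -> I)
    (g : I -> L) :
  2%N \in [pchar L] -> (forall x, involutive (op x)) ->
  (forall x y, G x -> G y -> G (op x y)) ->
  (forall x y, G x -> G y -> g (op x y) = g x + g y) ->
  (forall x, G x -> (g x == 0) || (g x == 1)) ->
  \sum_(x | G x) psi (g x) =
  if [forall (x | G x), g x == 0] then #|[pred x | G x]|%:Z else 0.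
Proof.
move=> charL opK opG gD g01; case: ifPn => [/forall_inP g0 | ].
  rewrite (eq_bigr (fun=> 1)) => [|x Gx]; last by rewrite (eqP (g0 x Gx)) psi0.
  by rewrite sumr_const natz.
rewrite negb_forall_in => /exists_inP[x0 Gx0 gx0].
apply: (@sum_sign_reversing _ _ _ (op x0)) => // [x|x Gx].
  by apply/idP/idP => [/(opG _ _ Gx0)|/(opG _ _ Gx0) //]; rewrite opK.
rewrite gD // psiD ?g01 //; move: (g01 _ Gx0); rewrite (negPf gx0) => /eqP->.
by rewrite psi1 mulN1r.
Qed.

Lemma card_fibers (I J : finType) (A : {set I}) (B : {set J}) (f : I -> J) k :
  (forall x, x \in A -> f x \in B) ->
  (forall b, #|[set x in A | f x == b]| <= k)%N -> (#|A| <= #|B| * k)%N.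
Proof.
move=> fAB fk; rewrite -sum1_card (partition_big f (mem B)) //=.
rewrite -sum_nat_const; apply: leq_sum => b _.
apply: leq_trans (fk b); rewrite -sum1_card; apply: eq_leq.
by apply: eq_bigl => x; rewrite inE.
Qed.

(** * Root bounds and vanishing sums for polynomials in a Frobenius power *)

Section FiniteField.
Variables (L : finFieldType).
Hypothesis charL : 2%N \in [pchar L].
Implicit Types (x y z w : L) (U : {set L}).

Definition fixf s : {set L} := [set x | fr s x == x].

(** Each fibre of [f] over [A] lies in a translate of the kernel. *)
Lemma card_fibers_additive (A B : {set L}) (f : L -> L) :
  (forall x y, f (x + y) = f x + f y) ->
  (forall x, x \in A -> f x \in B) ->
  (#|A| <= #|B| * #|[set x | f x == 0%R]|)%N.
Proof.
move=> fD fAB; apply: card_fibers fAB _ => b.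
case: (set_0Vmem [set x in A | f x == b]) => [->|[x0]]; first by rewrite cards0.
rewrite inE => /andP[_ /eqP fx0].
rewrite -(card_imset _ (addrI x0)); apply/subset_leq_card/subsetP => y.
case/imsetP => x; rewrite !inE => /andP[_ /eqP fx] ->.
by rewrite fD fx0 fx (addrr2 charL).
Qed.

Lemma abel_summation (c f : nat -> L) D :
  \sum_(i < D.+1) c i * f i =
  (\sum_(i < D.+1) c i) * f D +
  \sum_(i < D) (\sum_(l < i.+1) c l) * (f i.+1 + f i).
Proof.
elim: D => [|D IH]; first by rewrite !big_ord_recr !big_ord0 /= !add0r addr0.
rewrite big_ord_recr IH [in RHS]big_ord_recr /=.
rewrite [\sum_(i < D.+1) (_ * (_ + _))]big_ord_recr /=.
set S := \sum_(i < D.+1) c i; set R := \sum_(i < D) _.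
have -> : (S + c D.+1) * f D.+1 + (R + S * (f D.+1 + f D)) =
  S * f D + R + c D.+1 * f D.+1 + (S * f D.+1 + S * f D.+1) by ring.
by rewrite (addrr2 charL) addr0.
Qed.

(* If x0 is a nonzero root, then in terms of y = x / x0 the operator kills 1, and
   Abel summation factors it through y |-> sigma y - y, whose kernel is [fixf s]. *)
Lemma card_ker_fpoly s D (c : nat -> L) i0 : (i0 <= D)%N -> c i0 != 0 ->
  (#|[set x : L | (\sum_(i < D.+1) c i * fr (i * s) x)%R == 0%R]| <= #|fixf s| ^ D)%N.
Proof.
elim: D c i0 => [|D IH] c i0 i0D ci0.
  move: i0D ci0; rewrite leqn0 => /eqP-> c0.
  apply: leq_trans (eq_leq (cards1 (0 : L))).
  apply/subset_leq_card/subsetP => x.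
  by rewrite !inE big_ord1 fr0n mulf_eq0 (negPf c0).
set W := [set x | _]; have fixf0 : (0 < #|fixf s|)%N.
  by apply/card_gt0P; exists 0; rewrite inE fr0.
have [/subset_leq_card|] := boolP (W \subset [set 0]).
  by rewrite cards1 => /leq_trans; apply; rewrite expn_gt0 fixf0.
case/subsetPn => x0; rewrite inE inE => Wx0 x0n0.
pose c' i := c i * fr (i * s) x0; pose C i := \sum_(l < i.+1) c' l.
have CD : C D.+1 = 0 by apply/eqP.
(* As [C D.+1] is zero too, the vanishing of all earlier partial sums would make their differences
   vanish, among them [c' i0]. *)
have [j jD Cj] : exists2 j, (j <= D)%N & C j != 0.
  have [/existsP[j Cj]|] := boolP [exists j : 'I_D.+1, C j != 0].
    by exists j => //; rewrite -ltnS.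
  rewrite negb_exists => /forallP C0; suff : c' i0 = 0.
    by move/eqP; rewrite /c' mulf_eq0 (negPf ci0) fr_eq0 (negPf x0n0).
  have C0' j : (j <= D.+1)%N -> C j = 0.
    rewrite leq_eqVlt => /orP[/eqP->//|jD].
    by have := C0 (Ordinal jD); rewrite negbK => /eqP.
  case: i0 i0D {ci0} => [|i] iD; have := C0' _ iD; rewrite /C big_ord_recr /=.
    by rewrite big_ord0 add0r.
  by rewrite -/(C i) C0' ?add0r // ltnW.
have := IH C j jD Cj; set W' := [set x | _] => cW'.
have -> : #|W| = #|[set y | \sum_(i < D.+2) c' i * fr (i * s) y == 0]|.
  rewrite -(card_preimset W (mulfI x0n0)); apply: eq_card => y.
  rewrite !inE; congr (_ == 0); apply: eq_bigr => i _.
  by rewrite frM mulrA.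
(* The map [y |-> fr s y + y] sends the roots into the root set [W'] of an operator of degree [D],
   with fibres no larger than [fixf s]. *)
rewrite expnS mulnC.
apply: leq_trans (card_fibers_additive (f := fun y => fr s y + y) _ (B := W') _) _.
- by move=> x y; rewrite frD // addrACA.
- move=> y; rewrite !inE (abel_summation c' (fun i => fr (i * s) y)) -/(C D.+1) CD mul0r add0r.
  congr (_ == 0); apply: eq_bigr => i _.
  by rewrite frD // frA mulSn [(s + _)%N]addnC.
rewrite leq_mul //; apply/subset_leq_card/subsetP => y.
by rewrite !inE addr_eq0_2.
Qed.

(* Dividing by the value of one w makes its term constant in h, so that it drops out
   of the difference of two consecutive sums. *)
Lemma vanishing_window s (l : seq (L * L)) h0 :
  (forall h, (h0 <= h < h0 + size l)%N ->
     \sum_(p <- l) p.1 * fr (h * s) p.2 = 0) ->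
  forall h, (h0 <= h)%N -> \sum_(p <- l) p.1 * fr (h * s) p.2 = 0.
Proof.
have [n] := ubnP (size l); elim: n l => // n IH [|[c w] l] /=.
  by move=> *; rewrite big_nil.
rewrite ltnS => ln van; have [w0|w0] := eqVneq w 0.
  move=> h hh; rewrite big_cons /= w0 fr0 mulr0 add0r; apply: IH => //.
  move=> i ih; have := van i; rewrite big_cons /= w0 fr0 mulr0 add0r; apply; lia.
pose t h := c + \sum_(p <- l) p.1 * fr (h * s) (p.2 / w).
have tE h : \sum_(p <- (c, w) :: l) p.1 * fr (h * s) p.2 = fr (h * s) w * t h.
  rewrite big_cons /= mulrDr mulrC; congr (_ + _).
  rewrite mulr_sumr; apply: eq_bigr => p _.
  rewrite frM frV; have : fr (h * s) w != 0 by rewrite fr_eq0.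
  by move=> ?; field.
have t0 h : (h0 <= h <= h0 + size l)%N -> t h = 0.
  move=> hh; have /eqP := van h ltac:(lia); rewrite tE mulf_eq0 fr_eq0 (negPf w0).
  by move/eqP.
(* The increments of [t] are sums of the same kind over a list one pair shorter. The window also
   loses one index, because [t] must vanish at both [h] and [h.+1]. *)
pose l' := [seq (p.1, fr s (p.2 / w) + p.2 / w) | p <- l].
have tD h : t h.+1 = t h + \sum_(p <- l') p.1 * fr (h * s) p.2.
  rewrite big_map /t -addrA -big_split /=; congr (_ + _); apply: eq_bigr => p _.
  rewrite frD // frA -mulrDr addrCA (addrr2 charL) addr0; congr (_ * fr _ _); lia.
have D0 h : (h0 <= h)%N -> \sum_(p <- l') p.1 * fr (h * s) p.2 = 0.
  have sl : size l' = size l by exact: size_map.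
  apply: IH; rewrite sl // => i ih.
  have ti := t0 i ltac:(lia); have ti1 := t0 i.+1 ltac:(lia).
  by have := tD i; rewrite ti ti1 add0r.
move=> h hh; rewrite tE.
suff -> : t h = 0 by rewrite mulr0.
elim: h hh => [|h IHh] hh; first by apply: t0; lia.
have [e|ne] := eqVneq h0 h.+1; first by apply: t0; lia.
rewrite tD IHh ?add0r; last by lia.
by apply: D0; lia.
Qed.

End FiniteField.

(** * The absolute trace and the subfields of a field with 2^m elements *)

Section Trace.
Variables (L : finFieldType) (m : nat).
Hypothesis cardL : #|L| = (2 ^ m)%N.
Implicit Types (x y z w : L) (U : {set L}).

Lemma degree_gt0 : (0 < m)%N.
Proof.
case: m cardL => // cL; have : (1 < #|L|)%N by exact: finRing_gt1.
by rewrite cL.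
Qed.

Lemma pchar2 : 2%N \in [pchar L].
Proof. exact: card_finPcharP cardL isT. Qed.

Let charL := pchar2.

Lemma fr_card x : fr m x = x.
Proof. by rewrite /fr -cardL expf_card. Qed.

Lemma fr_card_mul t x : fr (m * t) x = x.
Proof. by elim: t => [|t IH]; rewrite ?muln0 ?fr0n // mulnS -frA IH fr_card. Qed.

Notation Tr := (frob_trace 1 m).

Lemma Tr_bool x : (Tr x == 0) || (Tr x == 1).
Proof. exact/frob_trace_bool/fr_card. Qed.

Lemma Tr_fr i x : Tr (fr i x) = Tr x.
Proof. exact/frob_trace_fr/fr_card. Qed.

(** For nonzero [y] the trace would vanish on all of [L], while as a Frobenius polynomial of degree
    m - 1 it has at most 2^(m - 1) roots. *)
Lemma Tr_nondeg y : (forall x, Tr (x * y) = 0) -> y = 0.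
Proof.
move=> Ty; apply/eqP; apply: contraT => y0.
have T0 x : Tr x = 0 by rewrite -[x](divfK y0) Ty.
have := @card_ker_fpoly L charL 1 m.-1 (fun=> 1) 0 isT (oner_neq0 _).
rewrite prednK ?degree_gt0 //.
have -> : [set x : L | \sum_(i < m) 1 * fr (i * 1) x == 0] = setT.
  apply/setP => x; rewrite !inE; apply/eqP; rewrite -[RHS](T0 x) frob_traceE.
  by apply: eq_bigr => i _; rewrite mul1r mulnC.
rewrite cardsT cardL leqNgt => /negP[].
have : (#|fixf L 1| <= 2)%N.
  rewrite -(card_bool) -(@card_imset _ _ (fun b : bool => (b%:R : L))).
    apply/subset_leq_card/subsetP => x; rewrite inE => /eqP/fr1_bool/orP[]/eqP->.
      by apply/imsetP; exists false.
    by apply/imsetP; exists true.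
  by move=> [] [] //= /eqP; rewrite ?oner_eq0 // eq_sym oner_eq0.
move=> le2.
have [->|m1] := posnP m.-1; first by rewrite expn0 -(expn0 2) ltn_exp2l ?degree_gt0.
apply: leq_ltn_trans (_ : 2 ^ m.-1 < _)%N; first by rewrite leq_exp2r.
by rewrite ltn_exp2l // prednK // degree_gt0.
Qed.

(** Bezout: some multiple of [d] is congruent to [gcdn m d] modulo [m], and [fr m] is the
    identity. *)
Lemma fixf_gcd d : (0 < d)%N -> fixf L d = fixf L (gcdn m d).
Proof.
move=> d0; apply/setP => x; rewrite !inE; apply/eqP/eqP => fx; last first.
  have /dvdnP[t ->] := dvdn_gcdr m d.
  by elim: t => [|t IH]; rewrite ?fr0n // mulSn -frA IH.
have frt t : fr (t * d) x = x.
  by elim: t => [|t IH]; rewrite ?fr0n // mulSn -frA IH.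
case: (egcdnP m d0) => km kn E _; have := frt km.
by rewrite E addnC -frA mulnC fr_card_mul gcdnC.
Qed.

Lemma frob_trace_fixf e x : (0 < e)%N -> (e %| m)%N ->
  frob_trace e (m %/ e) x \in fixf L e.
Proof.
move=> e0 em; have M0 : (0 < m %/ e)%N by rewrite divn_gt0 // dvdn_leq // degree_gt0.
have M1 : (e + e * (m %/ e).-1 = m)%N by rewrite -mulnS prednK // mulnC divnK.
rewrite inE frob_traceE fr_sum // -(prednK M0) big_ord_recr big_ord_recl addrC /=.
rewrite frA muln0 fr0n M1 fr_card.
by apply/eqP; congr (_ + _); apply: eq_bigr => i _; rewrite frA -mulnS.
Qed.

(** From above, count roots of X^(2^e) - X. From below, the trace maps [L] into the subfield K with
    a kernel of at most |K|^(m/e - 1) elements, whence |L| <= |K|^(m/e). *)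
Lemma card_fixf e : (0 < e)%N -> (e %| m)%N -> #|fixf L e| = (2 ^ e)%N.
Proof.
move=> e0 em; have q1 : (1 < 2 ^ e)%N by rewrite -(expn0 2) ltn_exp2l.
apply/eqP; rewrite eqn_leq; apply/andP; split.
  pose p : {poly L} := 'X^(2 ^ e) - 'X.
  have sp : size p = (2 ^ e).+1.
    by rewrite size_polyDl ?size_polyXn // size_polyN size_polyX.
  have p0 : p != 0 by rewrite -size_poly_eq0 sp.
  have := @max_poly_roots _ p (enum (fixf L e)) p0 _ (enum_uniq _).
  rewrite sp ltnS -cardE; apply; apply/allP => x.
  rewrite mem_enum inE => /eqP fx.
  by rewrite /root !hornerE subr_eq0; apply/eqP.
have M0 : (0 < m %/ e)%N by rewrite divn_gt0 // dvdn_leq // degree_gt0.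
rewrite -(leq_exp2r _ _ M0) -expnM mulnC divnK // -cardL -cardsT.
apply: leq_trans (@card_fibers_additive _ charL _ (fixf L e) (frob_trace e (m %/ e)) _ _) _.
- exact: frob_traceD.
- by move=> x _; apply: frob_trace_fixf.
rewrite -[X in (_ <= _ ^ X)%N](prednK M0) expnS leq_mul2l; apply/orP; right.
have := @card_ker_fpoly L charL e (m %/ e).-1 (fun=> 1) 0 isT (oner_neq0 _).
rewrite prednK //; congr (_ <= _)%N; apply: eq_card => x.
rewrite !inE frob_traceE; congr (_ == _); apply: eq_bigr => i _.
by rewrite mul1r mulnC.
Qed.

Lemma sum_psi U (g : L -> L) :
  (forall x y, x \in U -> y \in U -> x + y \in U) ->
  (forall x y, g (x + y) = g x + g y) ->
  (forall x, (g x == 0) || (g x == 1)) ->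
  \sum_(x in U) psi (g x) = if [forall x in U, g x == 0] then #|U|%:Z else 0.
Proof.
move=> UD gD g01; rewrite (@sum_psi_group _ _ (fun x => x \in U) +%R g) //.
by move=> x y; rewrite addrA (addrr2 charL) add0r.
Qed.

(** Both sides evaluate the sum of [psi (b z u)] over all [z] and all [u] in [U], taken in the two
    orders. *)
Lemma card_orthogonal U (b : L -> L -> L) :
  (forall x y, x \in U -> y \in U -> x + y \in U) ->
  (forall x y z, b x (y + z) = b x y + b x z) ->
  (forall x y z, b (x + y) z = b x z + b y z) ->
  (forall x y, (b x y == 0) || (b x y == 1)) ->
  (#|U| * #|[set z | [forall u in U, b z u == 0%R]]| =
   #|L| * #|[set u in U | [forall z, b z u == 0%R]]|)%N.
Proof.
move=> UD bDr bDl b01; suff : (#|U| * #|[set z | [forall u in U, b z u == 0%R]]|)%:Z =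
   (#|L| * #|[set u in U | [forall z, b z u == 0%R]]|)%:Z by move=> [].
have : \sum_z \sum_(u in U) psi (b z u) = \sum_(u in U) \sum_z psi (b z u).
  exact: exchange_big.
rewrite (eq_bigr (fun z => if [forall u in U, b z u == 0] then #|U|%:Z else 0)); last first.
  by move=> z _; apply: sum_psi.
rewrite [in RHS](eq_bigr (fun u => if [forall z, b z u == 0] then #|L|%:Z else 0)); last first.
  move=> u _; have := @sum_psi setT (b^~ u) (fun _ _ _ _ => in_setT _)
    (fun x y => bDl x y u) (fun x => b01 x u).
  rewrite cardsT; under eq_bigl do rewrite inE; move=> ->.
  by congr (if _ then _ else _); apply: eq_forallb => z; rewrite inE.
have mulE (i j : nat) : i%:Z *+ j = (i * j)%:Z by rewrite -mulr_natr natz PoszM.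
by rewrite -big_mkcond -big_mkcondr !sumr_const !mulE !cardsE.
Qed.

End Trace.

(** * Subspaces over the subfield [K], spans, and separation by the trace form *)

Section Subspaces.
Variables (L : finFieldType) (m e : nat).
Hypothesis cardL : #|L| = (2 ^ m)%N.
Hypotheses (e_gt0 : (0 < e)%N) (e_dvd : (e %| m)%N).
Implicit Types (x y z w c : L) (U V : {set L}) (s : seq L).

Let charL := pchar2 cardL.
Notation K := (fixf L e).
Notation q := (2 ^ e)%N.
Notation Tr := (frob_trace 1 m).
Notation TrK := (frob_trace e (m %/ e)).

Lemma fixf0 : 0 \in K. Proof. by rewrite inE fr0. Qed.

Lemma fixf1 : 1 \in K. Proof. by rewrite inE fr1. Qed.

Lemma fixfD x y : x \in K -> y \in K -> x + y \in K.
Proof. by rewrite !inE frD // => /eqP-> /eqP->. Qed.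

Lemma fixfM x y : x \in K -> y \in K -> x * y \in K.
Proof. by rewrite !inE frM => /eqP-> /eqP->. Qed.

Lemma fixfV x : x \in K -> x^-1 \in K.
Proof. by rewrite !inE frV => /eqP->. Qed.

Definition ksub U :=
  0 \in U /\ forall x y c, x \in U -> y \in U -> c \in K -> x + c * y \in U.

Definition extend x U : {set L} := [set p.1 + p.2 * x | p in setX U K].

Lemma ksubD U x y : ksub U -> x \in U -> y \in U -> x + y \in U.
Proof. by move=> [_ UP] xU yU; rewrite -[y]mul1r UP ?fixf1. Qed.

Lemma ksubZ U c y : ksub U -> c \in K -> y \in U -> c * y \in U.
Proof. by move=> [U0 UP] cK yU; rewrite -[_ * _]add0r UP. Qed.

Lemma extendP x U y :
  reflect (exists u c, [/\ u \in U, c \in K & y = u + c * x]) (y \in extend x U).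
Proof.
apply: (iffP imsetP) => [[[u c] /setXP[/= uU cK] ->]|[u [c [uU cK ->]]]].
  by exists u, c.
by exists (u, c); rewrite // in_setX uU.
Qed.

Lemma subset_extend x U : U \subset extend x U.
Proof.
apply/subsetP => u uU; apply/extendP; exists u, 0.
by rewrite uU fixf0 mul0r addr0.
Qed.

Lemma mem_extend x U : ksub U -> x \in extend x U.
Proof.
by case=> U0 _; apply/extendP; exists 0, 1; rewrite U0 fixf1 mul1r add0r.
Qed.

Lemma ksub_extend x U : ksub U -> ksub (extend x U).
Proof.
move=> kU; have [U0 UP] := kU; split; first exact: (subsetP (subset_extend x U)).
move=> y z c /extendP[u [a [uU aK ->]]] /extendP[v [b [vU bK ->]]] cK.
apply/extendP; exists (u + c * v), (a + c * b).
by rewrite UP // fixfD ?fixfM //; split=> //; ring.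
Qed.

Lemma extend_sub x U V : ksub V -> U \subset V -> x \in V -> extend x U \subset V.
Proof.
move=> [_ VP] /subsetP UV xV; apply/subsetP => y /extendP[u [c [uU cK ->]]].
by apply: VP => //; apply: UV.
Qed.

Lemma card_extend x U : ksub U -> x \notin U -> #|extend x U| = (#|U| * q)%N.
Proof.
move=> kU xU; rewrite card_in_imset ?cardsX ?(card_fixf cardL) //.
move=> [u c] [v b] /setXP[/= uU cK] /setXP[/= vU bK] E.
have cb : c + b = 0.
  apply: contraNeq xU => cb; have -> : x = (c + b)^-1 * (u + v).
    have -> : u + v = (c + b) * x; last by rewrite mulKf.
    apply/eqP; rewrite -addr_eq0_2 //.
    have -> : u + v + (c + b) * x = (u + c * x) + (v + b * x) by ring.
    by rewrite E addrr2.
  by apply: ksubZ => //; [rewrite fixfV ?fixfD|rewrite ksubD].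
move/eqP: cb; rewrite addr_eq0_2 // => /eqP cb; move: E; rewrite cb.
by move/addIr => ->.
Qed.

(** Starting from {0}, each adjunction of an element of [V] multiplies the size by [q]; [n] bounds
    the room left. *)
Lemma card_ksub V : ksub V -> exists t, #|V| = (q ^ t)%N.
Proof.
move=> kV; suff H n U t : (#|V| - #|U| < n)%N -> ksub U -> U \subset V ->
    #|U| = (q ^ t)%N -> exists t, #|V| = (q ^ t)%N.
  apply: (H _ [set 0] 0%N (ltnSn _)); rewrite ?cards1 ?sub1set //.
    split=> [|x y c]; rewrite ?inE // => /eqP-> /eqP-> _.
    by rewrite mulr0 addr0.
  by case: kV.
elim: n U t => // n IH U t lt kU UV cU.
have [VU|] := boolP (V \subset U).
  by exists t; rewrite -cU; apply: eq_card => x; apply/idP/idP; apply: subsetP.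
case/subsetPn => x xV xU; have exV := extend_sub kV UV xV.
apply: (IH (extend x U) t.+1) exV _; last by rewrite card_extend // cU expnSr.
  have := subset_leq_card (extend_sub kV UV xV); rewrite card_extend //.
  have := subset_leq_card UV; have : (1 < q)%N by rewrite -(expn0 2) ltn_exp2l.
  have : (0 < #|U|)%N by apply/card_gt0P; exists 0; case: kU.
  by move: lt; nia.
exact: ksub_extend.
Qed.

Definition kspan s : {set L} := foldr extend [set 0] s.

Fixpoint kfree s : bool :=
  if s is x :: s' then (x \notin kspan s') && kfree s' else true.

Lemma ksub_kspan s : ksub (kspan s).
Proof.
elim: s => [|x s IH] /=; last exact: ksub_extend.
by split=> [|x y c]; rewrite ?inE // => /eqP-> /eqP-> _; rewrite mulr0 addr0.
Qed.

Lemma kspan_sub s V : ksub V -> {subset s <= V} -> kspan s \subset V.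
Proof.
move=> kV; elim: s => [|x s IH] sV /=; first by rewrite sub1set; case: kV.
apply: extend_sub => //; last by rewrite sV ?mem_head.
by apply: IH => y ys; rewrite sV // inE ys orbT.
Qed.

Lemma mem_kspan s x : x \in s -> x \in kspan s.
Proof.
elim: s => //= y s IH; rewrite inE => /orP[/eqP->|/IH].
  exact/mem_extend/ksub_kspan.
exact/subsetP/subset_extend.
Qed.

Lemma card_kspan s : kfree s -> #|kspan s| = (q ^ size s)%N.
Proof.
elim: s => [|x s IH] /=; first by rewrite cards1.
case/andP => xs /IH cs; rewrite card_extend ?cs ?expnSr //.
exact: ksub_kspan.
Qed.

Lemma Tr_TrK x : Tr x = frob_trace 1 e (TrK x).
Proof. by rewrite frob_trace_comp // [(e * _)%N]mulnC divnK. Qed.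

Lemma TrK_in x : TrK x \in K.
Proof. exact: (frob_trace_fixf cardL x e_gt0 e_dvd). Qed.

Lemma TrKZ c x : c \in K -> TrK (c * x) = c * TrK x.
Proof.
rewrite inE => /eqP fc; rewrite !frob_traceE mulr_sumr; apply: eq_bigr => i _.
rewrite frM; congr (_ * _); elim: (i : nat) => [|j IH]; first by rewrite muln0 fr0n.
by rewrite mulnS -frA IH.
Qed.

(** Nondegeneracy of the trace form gives |V| |V^perp| = |L| for every subspace V, so enlarging [U]
    by [x] strictly shrinks the orthogonal. *)
Lemma separation U x : ksub U -> x \notin U ->
  exists2 w, forall u, u \in U -> TrK (w * u) = 0 & TrK (w * x) != 0.
Proof.
move=> kU xU; pose b w u := Tr (w * u).
have perpE V : ksub V ->
    (#|V| * #|[set w | [forall u in V, b w u == 0%R]]| = #|L|)%N.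
  move=> kV; rewrite (@card_orthogonal _ _ cardL) ; last first.
  - by move=> w u; apply: (Tr_bool cardL).
  - by move=> w u v; rewrite /b mulrDl frob_traceD.
  - by move=> w u v; rewrite /b mulrDr frob_traceD.
  - by move=> u v; apply: ksubD.
  rewrite -[RHS]muln1; congr (_ * _)%N; rewrite -(cards1 (0 : L)).
  apply: eq_card => u; rewrite !inE; apply/andP/eqP => [[_ /forallP bu]|->].
    by apply: (Tr_nondeg cardL) => w; apply/eqP/bu.
  by split; [case: kV | apply/forallP => w; rewrite /b mulr0 frob_trace0].
have [w wU wx] : exists2 w, forall u, u \in U -> Tr (w * u) = 0 & Tr (w * x) != 0.
  have := perpE _ kU; rewrite -(perpE _ (ksub_extend x kU)) card_extend //.
  set A := [set w | _]; set B := [set w | _] => cAB.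
  have /subsetPn[w] : ~~ (A \subset B).
    apply/negP => /subset_leq_card AB; have L0 : (0 < #|L|)%N by rewrite cardL expn_gt0.
    have := perpE _ kU; rewrite -/A => cA.
    have : (1 < q)%N by rewrite -(expn0 2) ltn_exp2l.
    move: L0 cAB AB; rewrite -cA => L0 cAB /(leq_mul (leqnn #|U|)).
    by move: L0; rewrite cAB mulnAC; nia.
  rewrite !inE /b => /forall_inP wU; rewrite negb_forall_in => /exists_inP[y yx wy].
  case/extendP: yx wy => u [c [uU cK ->]].
  rewrite mulrDr frob_traceD // (eqP (wU u uU)) add0r mulrA => wx.
  (* Absorbing the scalar into [w] turns non-orthogonality to [c * x] into non-orthogonality to
     [x]. *)
  exists (w * c) => // v vU; apply/eqP; rewrite -mulrA; apply: wU.
  exact: ksubZ.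
have [y Ty] : exists y, Tr y != 0.
  apply/existsP; apply: contraT; rewrite negb_exists => /forallP T0.
  have := oner_neq0 L; rewrite (@Tr_nondeg _ _ cardL 1) ?eqxx // => z.
  by apply/eqP; have := T0 (z * 1); rewrite negbK.
exists w; last first.
  by apply: contraNneq wx => wx; rewrite Tr_TrK wx frob_trace0.
(* If [TrK (w * u)] were nonzero, some [K]-multiple of [u], still in [U], would have the nonzero
   value [Tr y] as its trace against [w]. *)
move=> u uU; apply: contraNeq Ty => tu; rewrite Tr_TrK.
rewrite -[TrK y](divfK tu) -TrKZ ?fixfM ?fixfV ?TrK_in // -Tr_TrK mulrCA wU //.
by rewrite ksubZ ?fixfM ?fixfV ?TrK_in.
Qed.

End Subspaces.

(** * From moments with nodes q^i to moments with nodes q^(2i) *)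

Section QMoments.
Variables (F : fieldType) (q Y : F) (I : finType) (A : pred I) (X : I -> F) (kk : nat).
Hypothesis Y0 : Y != 0.
Notation G u a := (\prod_(i < u) (X a - q ^+ i)).
Notation g u := (\prod_(i < u) ((Y - q ^+ i) * q ^+ i.+1 / Y)).
Variable cA : F.
Hypothesis momG : forall u, (u <= kk)%N -> \sum_(a | A a) G u a = cA * g u.

(* The products
     R(s, v) = \prod_(i < s) (X - q^i) * \prod_(i < v) (X - q^(s + 1 + 2i))
   interpolate between R(s, 0) and R(1, v) = \prod_(i <= v) (X - q^(2i)), through
     R(s, v + 2) = R(s + 2, v) + (q^s - q^(s + 1 + 2(v + 1))) R(s, v + 1). *)
Lemma qmoment_mixed s v : (s + v <= kk)%N ->
  \sum_(a | A a) G s a * \prod_(i < v) (X a - q ^+ (s + 1 + 2 * i)) =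
  cA * g s * (q ^+ s / Y) ^+ v * \prod_(i < v) (Y - q ^+ (s + 1 + 2 * i)).
Proof.
have [n] := ubnP v; elim: n v s => // n IH [|[|v]] s vn sv.
- under eq_bigr do rewrite big_ord0 mulr1.
  by rewrite big_ord0 !mulr1 momG //; lia.
- under eq_bigr do rewrite big_ord1.
  have -> : \sum_(a | A a) G s a * (X a - q ^+ (s + 1 + 2 * (ord0 : 'I_1))) =
     \sum_(a | A a) G s.+1 a + (q ^+ s - q ^+ s.+1) * \sum_(a | A a) G s a.
    rewrite mulr_sumr -big_split; apply: eq_bigr => a _ /=.
    by rewrite big_ord_recr /= muln0 addn0 addn1; ring.
  rewrite !momG; try lia; rewrite big_ord_recr big_ord1 /= muln0 addn0 addn1.
  by rewrite expr1 exprS; field.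
set W := fun a => \prod_(i < v.+1) (X a - q ^+ (s + 1 + 2 * i)).
have -> : \sum_(a | A a) G s a * \prod_(i < v.+2) (X a - q ^+ (s + 1 + 2 * i)) =
   \sum_(a | A a) G s.+2 a * \prod_(i < v) (X a - q ^+ (s.+2 + 1 + 2 * i)) +
   (q ^+ s - q ^+ (s + 1 + 2 * v.+1)) * \sum_(a | A a) G s a * W a.
  rewrite mulr_sumr -big_split; apply: eq_bigr => a _ /=.
  rewrite big_ord_recr /= -/(W a).
  have -> : G s.+2 a * \prod_(i < v) (X a - q ^+ (s.+2 + 1 + 2 * i)) =
     G s a * (X a - q ^+ s) * W a.
    rewrite !big_ord_recr /= /W big_ord_recl /= muln0 addn0 addn1 -!mulrA.
    congr (_ * (_ * (_ * _))); first by rewrite addn1.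
    apply: eq_bigr => i _.
    by congr (_ - _ ^+ _); rewrite ?lift0 /= ?/bump; lia.
  by ring.
rewrite IH; try lia; rewrite IH; try lia.
rewrite [\prod_(i < s.+2) _]big_ord_recr [\prod_(i < s.+1) _]big_ord_recr /=.
rewrite [\prod_(i < v.+2) _]big_ord_recr /= [\prod_(i < v.+1) _]big_ord_recl /=.
have -> : \prod_(i < v) (Y - q ^+ (s + 1 + 2 * bump 0 i)) =
   \prod_(i < v) (Y - q ^+ (s.+2 + 1 + 2 * i)).
  by apply: eq_bigr => i _; congr (_ - _ ^+ _); rewrite ?lift0 /= ?/bump; lia.
set p1 := \prod_(i < s) _; set p2 := \prod_(i < v) _.
rewrite muln0 addn0.
have -> : q ^+ (s + 1 + 2 * v.+1) = q ^+ s * q ^+ v * q ^+ v * q * q * q.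
  by rewrite -!exprD -!exprSr; congr (_ ^+ _); lia.
rewrite !addn1 !exprS !expr_div_n !exprMn; field.
by rewrite expf_neq0 Y0.
Qed.

(** The mixed moment at s = 1: its factor [X a - 1] is the term i = 0, and the nodes q^(2 + 2i) are
    the remaining ones. *)
Lemma qmoment v : (v <= kk)%N ->
  \sum_(a | A a) \prod_(i < v) (X a - q ^+ (2 * i)) =
  cA * (q / Y) ^+ v * \prod_(i < v) (Y - q ^+ (2 * i)).
Proof.
case: v => [|v] vk.
  have := momG (leq0n kk); rewrite !big_ord0 !mulr1 => <-.
  by apply: eq_bigr => a _; rewrite !big_ord0.
have := @qmoment_mixed 1 v; rewrite add1n => /(_ vk).
rewrite big_ord1 expr0 => E.
rewrite (eq_bigr (fun a => G 1 a * \prod_(i < v) (X a - q ^+ (1 + 1 + 2 * i)))).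
  rewrite E big_ord_recl muln0 expr0 exprS.
  rewrite [in RHS](eq_bigr (fun i : 'I_v => Y - q ^+ (1 + 1 + 2 * i))).
    by rewrite expr0 mulr1 exprS; ring.
  by move=> i _; congr (_ - _ ^+ _); rewrite ?lift0 /= ?/bump; lia.
move=> a _; rewrite big_ord_recl big_ord1 muln0; congr (_ * _).
by apply: eq_bigr => i _; congr (_ - _ ^+ _); rewrite ?lift0 /= ?/bump; lia.
Qed.

End QMoments.

(** * Gaussian binomials and their inversion formula *)

Section GaussianBinomials.
Variable q : nat.
Hypothesis q_gt1 : (1 < q)%N.
Notation Q := (q%:R : rat).

Lemma Qn_sub1_neq0 i : Q ^+ i.+1 - 1 != 0.
Proof.
rewrite -natrX subr_eq0 pnatr_eq1 -(expn0 q) eqn_exp2l //.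
Qed.

Lemma Q_neq0 : Q != 0. Proof. by rewrite pnatr_eq0 -lt0n ltnW. Qed.

(** The factor of index [a] has numerator q^0 - 1. *)
Lemma gbinom_small a b : (a < b)%N -> gbinom q a b = 0.
Proof.
by move=> ab; rewrite /gbinom (bigD1 (Ordinal ab)) //= subnn expr0 subrr mul0r mul0r.
Qed.

Lemma gbinom0 a : gbinom q a 0 = 1. Proof. exact: big_ord0. Qed.

(** A rearrangement of the product of Q^v - Q^i over i < v; for a prime power this is the order of
    GL_v. *)
Definition gden v : rat := \prod_(i < v) (Q ^+ i * (Q ^+ i.+1 - 1)).

Lemma gden_neq0 v : gden v != 0.
Proof.
by apply/prodf_neq0 => i _; rewrite mulf_neq0 ?Qn_sub1_neq0 // expf_neq0 // Q_neq0.
Qed.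

(** Exhibits the binomial as a polynomial in Q^j, the shape in which kernel sizes enter. For j < v
    both sides vanish. *)
Lemma gbinomE j v : gbinom q j v = (\prod_(i < v) (Q ^+ j - Q ^+ i)) / gden v.
Proof.
case: (ltnP j v) => jv.
  by rewrite gbinom_small // (bigD1 (Ordinal jv)) //= subrr !mul0r.
rewrite /gden -prodf_div; apply: eq_bigr => i _.
have ij : (i <= j)%N by apply: ltnW; apply: leq_trans jv.
rewrite -{2}(subnKC ij) exprD.
have := Qn_sub1_neq0 i; have : Q ^+ i != 0 by rewrite expf_neq0 // Q_neq0.
by move=> ? ?; field; apply/andP.
Qed.

Lemma gbinom_pascal a t :
  gbinom q a.+1 t.+1 = Q ^+ t.+1 * gbinom q a t.+1 + gbinom q a t.
Proof.
have E1 : \prod_(i < t.+1) (Q ^+ a.+1 - Q ^+ i) =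
    (Q ^+ a.+1 - 1) * (Q ^+ t * \prod_(i < t) (Q ^+ a - Q ^+ i)).
  rewrite big_ord_recl; congr (_ * _).
  have -> : Q ^+ t = \prod_(i < t) Q by rewrite prodr_const card_ord.
  rewrite -big_split.
  by apply: eq_bigr => i _; rewrite lift0 /= !exprS mulrBr.
have E2 : gden t.+1 = gden t * (Q ^+ t * (Q ^+ t.+1 - 1)) by rewrite /gden big_ord_recr.
rewrite !gbinomE E1 E2 big_ord_recr /=.
have := gden_neq0 t; have := Qn_sub1_neq0 t.
have : Q ^+ t != 0 by rewrite expf_neq0 // Q_neq0.
rewrite !exprS => ? ? ?; field.
by do ?[apply/andP; split].
Qed.

Definition qfact n : rat := \prod_(i < n) (Q ^+ i.+1 - 1).

Lemma qfact_neq0 n : qfact n != 0.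
Proof. by apply/prodf_neq0 => i _; apply: Qn_sub1_neq0. Qed.

Lemma gbinom_fact a b : (b <= a)%N ->
  gbinom q a b = qfact a / (qfact b * qfact (a - b)).
Proof.
move=> ba; rewrite /gbinom prodf_div -/(qfact b).
suff -> : qfact a = \prod_(i < b) (Q ^+ (a - i) - 1) * qfact (a - b).
  have := qfact_neq0 b; have := qfact_neq0 (a - b) => ? ?; field.
  by apply/andP.
elim: b ba => [|b IH] ba; first by rewrite big_ord0 mul1r subn0.
rewrite IH ?(ltnW ba) // big_ord_recr /= -mulrA; congr (_ * _).
by rewrite -(subnSK ba) /qfact big_ord_recr /= mulrC.
Qed.

Lemma gbinom_trinomial i j t : (j + t <= i)%N ->
  gbinom q i (j + t) * gbinom q (j + t) j = gbinom q i j * gbinom q (i - j) t.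
Proof.
move=> jti; rewrite !gbinom_fact; try lia.
rewrite addKn subnDA.
have := (qfact_neq0 (j + t), qfact_neq0 j, qfact_neq0 t, qfact_neq0 (i - j),
  qfact_neq0 (i - j - t)).
by move=> [[[[? ?] ?] ?] ?]; field; do ?[apply/andP; split].
Qed.

(** By Pascal's rule each new summand is the difference of two consecutive right-hand sides. *)
Lemma gbinom_alternating_partial a M :
  \sum_(t < M.+1) (-1) ^+ t * Q ^+ 'C(t, 2) * gbinom q a.+1 t =
  (-1) ^+ M * Q ^+ 'C(M.+1, 2) * gbinom q a M.
Proof.
elim: M => [|M IH]; first by rewrite big_ord1 !gbinom0.
rewrite big_ord_recr IH /= gbinom_pascal [in RHS]binS bin1 exprD !exprS; ring.
Qed.

Lemma gbinom_alternating a M : (a < M)%N ->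
  \sum_(t < M) (-1) ^+ t * Q ^+ 'C(t, 2) * gbinom q a t = (a == 0%N)%:R.
Proof.
case: M => // M; rewrite ltnS; case: a => [|a] aM; last first.
  by rewrite gbinom_alternating_partial gbinom_small ?mulr0.
rewrite big_ord_recl gbinom0 big1 ?addr0 ?mulr1 // => i _.
by rewrite gbinom_small ?mulr0.
Qed.

(** Trinomial revision pulls out [gbinom q i j] and leaves the alternating sum for [i - j]. *)
Lemma gbinom_orthogonal i j M : (i < M)%N ->
  \sum_(j <= v < M) (-1) ^+ (v - j) * Q ^+ 'C(v - j, 2) *
     gbinom q v j * gbinom q i v = (i == j)%:R.
Proof.
move=> iM; case: (ltnP i j) => ij.
  rewrite (ltn_eqF ij) big_nat big1 // => v /andP[jv _].
  by rewrite [gbinom q i v]gbinom_small ?mulr0 //; lia.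
rewrite -{1}[j]add0n big_addn big_mkord.
rewrite (eq_bigr (fun t : 'I__ => gbinom q i j *
   ((-1) ^+ t * Q ^+ 'C(t, 2) * gbinom q (i - j) t))) => [|t _]; last first.
  rewrite addnK; case: (leqP (j + t) i) => jti.
    rewrite [(t + j)%N]addnC -!mulrA [_ (j + t)%N j * _]mulrC gbinom_trinomial //; ring.
  have -> : gbinom q i (t + j) = 0 by apply: gbinom_small => //; lia.
  have -> : gbinom q (i - j) t = 0 by apply: gbinom_small => //; lia.
  by rewrite !mulr0.
rewrite -mulr_sumr gbinom_alternating; last by lia.
have -> : (i - j == 0)%N = (i == j) by lia.
case: eqP => [->|]; rewrite ?mulr0 // gbinom_fact //.
by rewrite subnn /qfact big_ord0 mulr1 mulr1 divff ?qfact_neq0.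
Qed.

(** Multiplication by the inverse triangular matrix of [gbinom_orthogonal]; truncation at [M] loses
    nothing because [gbinom q i v] is zero for v > i. *)
Lemma gbinom_inversion (A B : nat -> rat) M :
  (forall v, (v < M)%N -> \sum_(i < M) A i * gbinom q i v = B v) ->
  forall j, (j < M)%N ->
  A j = \sum_(j <= v < M) (-1) ^+ (v - j) * Q ^+ 'C(v - j, 2) * gbinom q v j * B v.
Proof.
move=> AB j jM; transitivity (\sum_(i < M) A i * (i == j :> nat)%:R).
  rewrite (bigD1 (Ordinal jM)) //= eqxx mulr1 big1 ?addr0 // => i ij.
  by rewrite (negPf ij : (i == j :> nat) = false) mulr0.
rewrite (eq_bigr (fun i : 'I_M => \sum_(j <= v < M) (-1) ^+ (v - j) * Q ^+ 'C(v - j, 2) *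
     gbinom q v j * (A i * gbinom q i v))) => [|i _]; last first.
  by rewrite -(gbinom_orthogonal j (ltn_ord i)) mulr_sumr; apply: eq_bigr => v _; ring.
rewrite exchange_big; apply: eq_big_nat => v /andP[_ vM].
by rewrite -AB // mulr_sumr.
Qed.

End GaussianBinomials.

(** * The quadratic forms of the code and their polarisation *)

Section Forms.
Variables (L : finFieldType) (m n d e k : nat).
Hypothesis cardL : #|L| = (2 ^ m)%N.
Hypotheses (n_gt0 : (0 < n)%N) (d_gt0 : (0 < d)%N) (k_gt0 : (0 < k)%N).
Hypotheses (mE : m = (2 * n)%N) (eEn : e = gcdn n d) (eEm : e = gcdn m d).
Hypothesis k_le : (k <= n %/ e)%N.
Implicit Types (x y z w c : L) (a b : {ffun 'I_k.+1 -> L}) (l : seq (L * L)).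

Let charL := pchar2 cardL.
Notation K := (fixf L e).
Notation q := (2 ^ e)%N.
Notation N := (n %/ e)%N.
Notation P := (param_set L n k).
Notation Tr := (frob_trace 1 m).
Notation TrK := (frob_trace e (m %/ e)).
Notation sg h := (@fr L (h * d)).

Lemma e_gt0 : (0 < e)%N. Proof. by rewrite eEn gcdn_gt0 n_gt0. Qed.

Lemma e_dvdn : (e %| n)%N. Proof. by rewrite eEn dvdn_gcdl. Qed.

Lemma e_dvdd : (e %| d)%N. Proof. by rewrite eEn dvdn_gcdr. Qed.

Lemma e_dvdm : (e %| m)%N. Proof. by rewrite mE dvdn_mull // e_dvdn. Qed.

Lemma divn_mul_d : (N * d = n * (d %/ e))%N.
Proof. by rewrite divn_mulAC ?e_dvdn // muln_divA ?e_dvdd. Qed.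

Lemma m_div_e : (m %/ e = 2 * N)%N.
Proof. by rewrite mE muln_divA // e_dvdn. Qed.

(** Were d/e even, 2e would divide both d and m = 2n, hence their gcd e. *)
Lemma odd_d_div_e : odd (d %/ e).
Proof.
apply: contraT => ev; have : (2 * e %| e)%N.
  rewrite {2}eEm mE dvdn_gcd dvdn_pmul2l // e_dvdn /=.
  by rewrite -(divnK e_dvdd) dvdn_pmul2r ?e_gt0 // dvdn2.
by move/(dvdn_leq e_gt0); have := e_gt0; lia.
Qed.

(** The exponent is an odd multiple of [n], hence [n] modulo [m]: sigma^N is the conjugation of [L]
    over the field with 2^n elements. *)
Lemma sgN x : sg N x = fr n x.
Proof.
rewrite divn_mul_d -(odd_double_half (d %/ e)) odd_d_div_e mulnDr muln1 -frA.
have -> : (n * (d %/ e)./2.*2 = m * (d %/ e)./2)%N by rewrite mE; lia.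
by rewrite fr_card_mul.
Qed.

Lemma sgNN h h' x : (h + h' = 2 * N)%N -> sg h (sg h' x) = x.
Proof.
by move=> E; rewrite frA -mulnDl E -mulnA divn_mul_d mulnA -mE fr_card_mul.
Qed.

(** As [sg (N + j)] inverts [sg (N - j)], the second term of each summand is the adjoint of the
    first for the trace form. *)
Definition La a x : L :=
  a ord0 * sg N x +
  \sum_(1 <= j < k) (a (inord j) * sg (N - j) x + sg (N + j) (a (inord j) * x)).

Definition beta a x z : L := Tr (z * La a x).

Definition fa a x : L := frob_trace 1 e (Qa m n d e a x).

Lemma paramP a : reflect (fr n (a ord0) = a ord0) (a \in P).
Proof. by rewrite inE; apply: eqP. Qed.

Lemma paramD a b : a \in P -> b \in P -> a + b \in P.
Proof. by move=> /paramP aP /paramP bP; apply/paramP; rewrite ffunE frD // aP bP. Qed.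

Lemma LaD a x y : La a (x + y) = La a x + La a y.
Proof.
rewrite /La !frD // mulrDr addrACA -big_split; congr (_ + _).
by apply: eq_bigr => j _; rewrite frD // !mulrDr frD // addrACA.
Qed.

Lemma LaDa a b x : La (a + b) x = La a x + La b x.
Proof.
rewrite /La ffunE mulrDl addrACA -big_split; congr (_ + _).
by apply: eq_bigr => j _; rewrite ffunE !mulrDl frD // addrACA.
Qed.

Lemma LaZ a c x : c \in K -> La a (c * x) = c * La a x.
Proof.
rewrite inE => /eqP fc; have sgc h : sg h c = c.
  have fct t : fr (t * e) c = c.
    by elim: t => [|t IH]; rewrite ?fr0n // mulSn -frA IH.
  by rewrite -(divnK e_dvdd) mulnA fct.
rewrite /La mulrDr mulr_sumr frM sgc mulrCA; congr (_ + _).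
by apply: eq_bigr => j _; rewrite !frM !sgc; ring.
Qed.

Lemma betaDa a b x z : beta (a + b) x z = beta a x z + beta b x z.
Proof. by rewrite /beta LaDa mulrDr frob_traceD. Qed.

Lemma betaDl a x y z : beta a (x + y) z = beta a x z + beta a y z.
Proof. by rewrite /beta LaD mulrDr frob_traceD. Qed.

Lemma betaDr a x y z : beta a x (y + z) = beta a x y + beta a x z.
Proof. by rewrite /beta mulrDl frob_traceD. Qed.

Lemma beta_bool a x z : (beta a x z == 0) || (beta a x z == 1).
Proof. exact: Tr_bool. Qed.

Lemma betaE a x z : beta a x z =
  Tr (a ord0 * (z * sg N x)) +
  \sum_(1 <= j < k) Tr (a (inord j) * (z * sg (N - j) x + x * sg (N - j) z)).
Proof.
rewrite /beta mulrDr frob_traceD // mulrCA; congr (_ + _).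
rewrite mulr_sumr frob_trace_sum //; apply: eq_big_nat => j /andP[_ jk].
rewrite mulrDr frob_traceD // mulrDr frob_traceD // mulrCA; congr (_ + _).
rewrite -(@Tr_fr _ _ cardL ((N - j) * d)) frM sgNN; last by lia.
by congr (frob_trace 1 m); ring.
Qed.

Lemma beta_sym a x z : a \in P -> beta a x z = beta a z x.
Proof.
move/paramP=> a0; rewrite !betaE; congr (_ + _); last first.
  by apply: eq_bigr => j _; rewrite [in RHS]addrC.
rewrite -(@Tr_fr _ _ cardL (N * d)) !frM sgNN; last by lia.
by rewrite sgN a0; congr (frob_trace 1 m); ring.
Qed.

Lemma faE a x : fa a x =
  frob_trace 1 n (a ord0 * (sg N x * x)) +
  \sum_(1 <= j < k) Tr (a (inord j) * (sg (N - j) x * x)) +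
  Tr (a (inord k) * x).
Proof.
rewrite /fa /Qa !frob_traceD // frob_trace_sum // !frob_trace_comp //.
rewrite ![(e * _)%N]mulnC !divnK ?e_dvdn ?e_dvdm // -divn_mul_d exprD expr1.
congr (_ + _ + _); apply: eq_bigr => j _.
by rewrite frob_trace_comp // mulnC divnK ?e_dvdm // exprD expr1.
Qed.

Lemma faDa a b x : fa (a + b) x = fa a x + fa b x.
Proof.
rewrite !faE !ffunE !mulrDl !frob_traceD // [RHS]addrACA; congr (_ + _).
rewrite addrACA; congr (_ + _); rewrite -big_split; apply: eq_bigr => j _.
by rewrite ffunE mulrDl frob_traceD.
Qed.

(** The norm [sg N x * x] lies in the subfield with 2^n elements, and so does its multiple by
    [a_0]. *)
Lemma fa_bool a x : a \in P -> (fa a x == 0) || (fa a x == 1).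
Proof.
move/paramP => aP; apply: fr1_bool; rewrite faE !frD // fr_sum //.
have frTr y : fr 1 (Tr y) = Tr y by apply/fr_frob_trace/fr_card.
rewrite frTr; under eq_bigr do rewrite frTr.
rewrite fr_frob_trace // !frM aP; congr (_ * _); rewrite -sgN sgNN; last by lia.
by rewrite mulrC -sgN.
Qed.

Lemma fa0 a : fa a 0 = 0.
Proof.
rewrite faE !mulr0 !frob_trace0 // big1 ?addr0 // => j _.
by rewrite !mulr0 frob_trace0.
Qed.

Lemma faD a x z : a \in P -> fa a (x + z) = fa a x + fa a z + beta a x z.
Proof.
move=> aP; have a0 := paramP _ aP; rewrite betaE !faE.
(* The two cross terms of the [a_0] summand are conjugate under [fr n], so the subfield trace of
   their sum is the full trace of one of them. *)
have -> : Tr (a ord0 * (z * sg N x)) =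
    frob_trace 1 n (a ord0 * (z * sg N x) + a ord0 * (sg N z * x)).
  rewrite mE -frob_trace_double // !frM a0 -!sgN sgNN //; lia.
set s1 := \sum_(1 <= j < k) Tr (_ * (_ * x)).
set s2 := \sum_(1 <= j < k) Tr (_ * (_ * z)).
set s3 := \sum_(1 <= j < k) Tr (_ * (z * _ + _)).
have -> : \sum_(1 <= j < k) Tr (a (inord j) * (sg (N - j) (x + z) * (x + z))) =
    s1 + s2 + s3.
  rewrite /s1 /s2 /s3 -!big_split; apply: eq_bigr => j _ /=.
  by rewrite -!frob_traceD // frD //; congr (frob_trace _ _); ring.
rewrite [a (inord k) * _]mulrDr [Tr (_ + _)]frob_traceD //.
have -> : frob_trace 1 n (a ord0 * (sg N (x + z) * (x + z))) =
  frob_trace 1 n (a ord0 * (sg N x * x)) + frob_trace 1 n (a ord0 * (sg N z * z))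
  + frob_trace 1 n (a ord0 * (z * sg N x) + a ord0 * (sg N z * x)).
  by rewrite -!frob_traceD // frD //; congr (frob_trace _ _); ring.
by ring.
Qed.

Lemma beta_diag a x : a \in P -> beta a x x = 0.
Proof.
move=> aP; have := faD x x aP; rewrite addrr2 // fa0 addrr2 // add0r.
by move=> <-.
Qed.

(** [c] is the square of some [u] in [K], and linearity over [K] shares the two factors [u] between
    the arguments, reducing to the diagonal. *)
Lemma beta_alt a x c : a \in P -> c \in K -> beta a x (c * x) = 0.
Proof.
move=> aP; rewrite inE => /eqP fc; pose u := fr e.-1 c.
have uK : u \in K by rewrite inE /u frA addnC -frA fc.
have -> : c = u * u.
  by rewrite -expr2 -[u ^+ 2]/(fr 1 u) /u frA add1n prednK ?e_gt0.
have -> : beta a x (u * u * x) = beta a (u * x) (u * x); last exact: beta_diag.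
by rewrite /beta LaZ //; congr (frob_trace _ _); ring.
Qed.

(** * Relations between values of the forms, read in the exterior square *)

Definition sform h l : L := \sum_(p <- l) (p.1 * sg h p.2 + p.2 * sg h p.1).

Lemma inord_eq i j : (i <= k)%N -> (j <= k)%N ->
  ((inord i : 'I_k.+1) == inord j) = (i == j).
Proof. by move=> ik jk; rewrite -val_eqE /= !inordK. Qed.

(** Parameters with one nonzero coordinate isolate [sform (N - j)], and the trace is nondegenerate.
    For j = 0 the coordinate must lie in the subfield, hence [y + fr n y]. *)
Lemma sform_eq0 l :
  (forall a, a \in P -> \sum_(p <- l) beta a p.1 p.2 = 0) ->
  forall j, (j < k)%N -> sform (N - j) l = 0.
Proof.
move=> triv [|j] jk; rewrite ?subn0.
  pose w := \sum_(p <- l) p.2 * sg N p.1.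
  have -> : sform N l = w + fr n w.
    rewrite /w fr_sum // -big_split; apply: eq_bigr => p _.
    by rewrite frM -!sgN sgNN; [rewrite addrC [p.1 * _]mulrC | lia].
  apply: (Tr_nondeg cardL) => y.
  pose a : {ffun 'I_k.+1 -> L} := [ffun i => if i == ord0 then y + fr n y else 0].
  have aP : a \in P.
    apply/paramP; rewrite ffunE eqxx frD // frA addnn -mul2n -mE.
    by rewrite (fr_card cardL) addrC.
  rewrite -[RHS](triv a aP) (eq_bigr (fun p => Tr ((y + fr n y) * (p.2 * sg N p.1)))).
    rewrite -frob_trace_sum // -mulr_sumr -/w.
    rewrite mulrDl mulrDr !frob_traceD //; congr (_ + _).
    rewrite -[LHS](Tr_fr cardL n) frM frA addnn -mul2n -mE.
    by rewrite (fr_card cardL).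
  move=> p _; rewrite betaE ffunE eqxx big_nat big1 ?addr0 // => i /andP[i0 ik].
  rewrite ffunE; case: eqP => [/(congr1 val)/=|]; rewrite ?inordK; try lia.
  by rewrite mul0r frob_trace0.
apply: (Tr_nondeg cardL) => y.
pose a : {ffun 'I_k.+1 -> L} := [ffun i => if i == inord j.+1 then y else 0].
have o0 : (ord0 == inord j.+1 :> 'I_k.+1) = false.
  by apply/eqP => /(congr1 val) /=; rewrite inordK; lia.
have aP : a \in P by apply/paramP; rewrite ffunE o0 fr0.
rewrite -[RHS](triv a aP) /sform mulr_sumr frob_trace_sum //.
apply: eq_bigr => p _; rewrite betaE ffunE o0 mul0r frob_trace0 // add0r.
rewrite (bigD1_seq j.+1) ?mem_index_iota ?iota_uniq //= ffunE eqxx big1_seq.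
  by rewrite addr0 addrC.
move=> i /andP[ij]; rewrite mem_index_iota => ik; rewrite ffunE inord_eq; try lia.
by rewrite (negPf ij) mul0r frob_trace0.
Qed.

(** The symmetry between h and 2N - h gives vanishing at the 2k - 1 exponents centred at N, and the
    sum has at most 2k - 2 terms, so [vanishing_window] applies. *)
Lemma sform_eq0_all l : (2 * size l < 2 * k)%N ->
  (forall a, a \in P -> \sum_(p <- l) beta a p.1 p.2 = 0) ->
  forall i, \sum_(p <- l) (p.1 * fr (e * i) p.2 + p.2 * fr (e * i) p.1) = 0.
Proof.
move=> lk triv i; have s0 := sform_eq0 triv.
pose h0 := (N - k.-1)%N; pose l' := l ++ [seq (p.2, p.1) | p <- l].
have l'E t : \sum_(p <- l) (p.1 * fr t p.2 + p.2 * fr t p.1) =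
    \sum_(p <- l') p.1 * fr t p.2.
  by rewrite big_split big_cat big_map.
have van h : (h0 <= h)%N -> \sum_(p <- l') p.1 * sg h p.2 = 0.
  apply: vanishing_window => // {}h hh.
  have {hh} : (h0 <= h <= N + k.-1)%N.
    by move: hh; rewrite size_cat size_map /h0; lia.
  rewrite -l'E; case: (leqP h N) => hN hh.
    have jk : (N - h < k)%N by move: hh; rewrite /h0; lia.
    by have := s0 _ jk; rewrite subKn.
  have hN' : (N - (h - N) + h = 2 * N)%N by move: hh; rewrite /h0; lia.
  have jk : (h - N < k)%N by move: hh; rewrite /h0; lia.
  have /(congr1 (sg h)) := s0 _ jk; rewrite /sform fr0 fr_sum // => E; rewrite -[RHS]E.
  apply: eq_bigr => p _; rewrite frD // !frM !sgNN; try lia.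
  by rewrite addrC mulrC [X in _ + X]mulrC.
(* By Bezout [fr e] is sigma^km. The summand [m * h0] only lifts the exponent above [h0], as sigma^m
   is the identity. *)
case: (egcdnP m d_gt0) => km kn E _.
have h0le : (h0 <= i * km + m * h0)%N by have := degree_gt0 cardL; nia.
rewrite -[RHS](van _ h0le).
rewrite -l'E; apply: eq_bigr => p _.
have fE x : sg (i * km + m * h0)%N x = fr (e * i) x.
  have -> : ((i * km + m * h0) * d = e * i + m * (i * kn + h0 * d))%N.
    rewrite mulnDl -mulnA E eEm gcdnC; lia.
  by rewrite -frA (fr_card_mul cardL).
by rewrite !fE.
Qed.

(* The vanishing of x ^ z + \sum x_i ^ z_i in the exterior square over K, contracted
   with some w orthogonal to all the x_i but not to x, expresses z. *)
Lemma trivial_pairs_kspan x z l : (size l < k.-1)%N ->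
  x \notin kspan e (unzip1 l) ->
  (forall a, a \in P -> beta a x z + \sum_(p <- l) beta a p.1 p.2 = 0) ->
  z \in kspan e (x :: unzip1 l).
Proof.
move=> lk xl triv.
have kU := @ksub_kspan L m e cardL (unzip1 l).
have kV := @ksub_kspan L m e cardL (x :: unzip1 l).
have [w wU wx] := separation cardL e_gt0 e_dvdm kU xl.
have van := @sform_eq0_all ((x, z) :: l) _ _.
have {}van i : x * fr (e * i) z + z * fr (e * i) x +
    \sum_(p <- l) (p.1 * fr (e * i) p.2 + p.2 * fr (e * i) p.1) = 0.
  rewrite -[RHS](van _ _ i) ?big_cons //=; first by lia.
  by move=> a aP; rewrite big_cons triv.
have trE y : TrK (w * y) = \sum_(i < m %/ e) fr (e * i) w * fr (e * i) y.
  by rewrite frob_traceE; apply: eq_bigr => i _; rewrite frM.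
(* The relations [van i] are summed with weights [fr (e * i) w]: Frobenius sums become traces, and
   those of [w * p.1] vanish. *)
have S0 : z * TrK (w * x) = x * TrK (w * z) + \sum_(p <- l) p.1 * TrK (w * p.2).
  apply/eqP; rewrite -addr_eq0_2 //.
  have -> : \sum_(p <- l) p.1 * TrK (w * p.2) =
     \sum_(p <- l) (p.1 * TrK (w * p.2) + p.2 * TrK (w * p.1)).
    apply: eq_big_seq => p pl; rewrite [TrK (w * p.1)]wU ?mulr0 ?addr0 //.
    by apply: (mem_kspan e cardL); apply: map_f.
  have -> : \sum_(p <- l) (p.1 * TrK (w * p.2) + p.2 * TrK (w * p.1)) =
     \sum_(i < m %/ e) fr (e * i) w *
       \sum_(p <- l) (p.1 * fr (e * i) p.2 + p.2 * fr (e * i) p.1).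
    under [RHS]eq_bigr do rewrite mulr_sumr.
    rewrite exchange_big; apply: eq_bigr => p _.
    rewrite !trE !mulr_sumr -big_split; apply: eq_bigr => i _ /=; ring.
  rewrite addrA [z * _ + _]addrC !trE !mulr_sumr -!big_split big1 //= => i _.
  have /(congr1 ( *%R (fr (e * i) w))) := van i; rewrite mulr0 => E.
  by rewrite -[RHS]E; ring.
have -> : z = (TrK (w * x))^-1 * (z * TrK (w * x)) by rewrite mulrC mulfK.
have TK y : TrK y \in K := TrK_in cardL e_gt0 e_dvdm y.
apply: (ksubZ kV); first by apply: fixfV.
rewrite S0; apply: (ksubD kV).
  by rewrite mulrC; apply: (ksubZ kV) => //; apply: (mem_kspan e cardL); rewrite mem_head.
rewrite big_seq; elim/big_ind: _ => [|u v uV vV|p pl]; first by case: kV.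
  exact: (ksubD kV).
rewrite mulrC; apply: (ksubZ kV) => //; apply: (mem_kspan e cardL).
by rewrite inE map_f ?orbT.
Qed.

(** * Counting the parameters whose operator kills given vectors *)

Definition kera a : {set L} := [set x | La a x == 0].

Lemma ksub_kera a : ksub e (kera a).
Proof.
split=> [|x y c].
    rewrite inE /La fr0 mulr0 add0r big1 // => j _.
    by rewrite fr0 !mulr0 fr0 addr0.
by rewrite ![_ \in kera a]inE => /eqP x0 /eqP y0 cK; rewrite LaD LaZ // x0 y0 mulr0 addr0.
Qed.

Lemma kera_beta a x : (x \in kera a) = [forall z, beta a x z == 0].
Proof.
rewrite inE; apply/eqP/forallP => [x0 z|b0]; first by rewrite /beta x0 mulr0 frob_trace0.
by apply: (Tr_nondeg cardL) => z; apply/eqP/b0.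
Qed.

Lemma sum_psi_beta a x :
  \sum_z psi (beta a x z) = if x \in kera a then #|L|%:Z else 0.
Proof.
have := @sum_psi _ _ cardL setT (beta a x) (fun _ _ _ _ => in_setT _)
  (betaDr a x) (beta_bool a x).
rewrite cardsT kera_beta; under eq_bigl do rewrite inE; move=> ->.
by congr (if _ then _ else _); apply: eq_forallb => z; rewrite inE.
Qed.

Definition Kset (s : seq L) := [set a in P | all (mem (kera a)) s].

Lemma KsetE s a : (a \in Kset s) = (a \in P) && all (mem (kera a)) s.
Proof. exact: in_set. Qed.

Lemma Kset_cons x s a : (a \in Kset (x :: s)) = (a \in Kset s) && (x \in kera a).
Proof. by rewrite !KsetE /= andbA andbAC. Qed.

Notation bsum acc a := (\sum_(p <- acc) beta a p.1 p.2).

Lemma ffun_addrr2 a : a + a = 0.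
Proof. by apply/ffunP => i; rewrite !ffunE addrr2. Qed.

Lemma bsum_bool acc a : (bsum acc a == 0) || (bsum acc a == 1).
Proof.
elim/big_ind: _ => [|x y|p _]; rewrite ?eqxx ?beta_bool //.
exact: boolD.
Qed.

(* Detects the condition La a x = 0 by summing characters over z; the pairs (x, z)
   met on the way are collected in [acc]. *)
Lemma sum_Kset_eq0 (s : seq L) acc :
  (forall l, unzip1 l = s ->
     exists2 a, a \in P & bsum acc a + bsum l a != 0) ->
  \sum_(a in Kset s) psi (bsum acc a) = 0.
Proof.
elim: s acc => [|x s IH] acc H.
  have -> : \sum_(a in Kset [::]) psi (bsum acc a) = \sum_(a in P) psi (bsum acc a).
    by apply: eq_bigl => a; rewrite inE andbT.
  have opK a : involutive (+%R a) by move=> b; rewrite addrA ffun_addrr2 add0r.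
  have gD a b : a \in P -> b \in P -> bsum acc (a + b) = bsum acc a + bsum acc b.
    by move=> _ _; rewrite -big_split; apply: eq_bigr => p _; rewrite betaDa.
  rewrite (sum_psi_group charL opK (@paramD) gD (fun a _ => bsum_bool acc a)).
  case: ifP => // /forall_inP triv; have [a aP] := H [::] erefl.
  by rewrite big_nil addr0 (eqP (triv a aP)) eqxx.
have L0 : #|L|%:Z != 0 by rewrite cardL -lt0n expn_gt0.
apply: (mulfI L0); rewrite mulr0 mulr_sumr.
have -> : \sum_(a in Kset (x :: s)) #|L|%:Z * psi (bsum acc a) =
    \sum_(a in Kset s) \sum_z psi (bsum ((x, z) :: acc) a).
  rewrite [RHS](eq_bigr (fun a => (if x \in kera a then #|L|%:Z else 0) *
     psi (bsum acc a))).
    rewrite [LHS]big_mkcond [RHS]big_mkcond; apply: eq_bigr => a _.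
    by rewrite Kset_cons; case: (a \in Kset s); case: (x \in kera a); rewrite ?mul0r.
  move=> a _; rewrite -sum_psi_beta mulr_suml; apply: eq_bigr => z _.
  by rewrite big_cons psiD ?beta_bool ?bsum_bool.
rewrite exchange_big big1 // => z _; apply: IH => l ls.
have [a aP Ha] := H ((x, z) :: l) (congr1 (cons x) ls); exists a => //.
suff <- : bsum acc a + bsum ((x, z) :: l) a = bsum ((x, z) :: acc) a + bsum l a by [].
by rewrite !big_cons /=; ring.
Qed.

Lemma kspan_Kset s a : a \in Kset s -> kspan e s \subset kera a.
Proof.
by rewrite inE => /andP[_ /allP sa]; apply: kspan_sub => //; apply: ksub_kera.
Qed.

(** In the sum of [psi (beta a x z)] over [z] and over [a] in [Kset s], every term with [z] in the
    span of [x :: s] is 1, while for any other [z] the sum over [a] is zero. *)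
Lemma card_Kset_cons x s : (size s < k.-1)%N -> kfree e (x :: s) ->
  (#|Kset (x :: s)| * #|L| = #|Kset s| * q ^ (size s).+1)%N.
Proof.
move=> sk fs; have /andP[xs _] := fs.
have mulE (i j : nat) : i%:Z *+ j = (i * j)%:Z by rewrite -mulr_natr natz PoszM.
suff : (#|L| * #|Kset (x :: s)|)%:Z = (#|Kset s| * q ^ (size s).+1)%:Z.
  by rewrite mulnC => -[].
have : \sum_(a in Kset s) \sum_z psi (beta a x z) =
    \sum_z \sum_(a in Kset s) psi (beta a x z) by exact: exchange_big.
rewrite (eq_bigr _ (fun a _ => sum_psi_beta a x)) -big_mkcondr sumr_const mulE.
have -> : #|[pred a in Kset s | x \in kera a]| = #|Kset (x :: s)|.
  by apply: eq_card => a; rewrite Kset_cons.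
move=> ->; rewrite -[(size s).+1]/(size (x :: s)) -(card_kspan cardL e_gt0 e_dvdm fs).
rewrite -mulE -sumr_const [RHS]big_mkcond; apply: eq_bigr => z _.
case: ifPn => zs.
  rewrite (eq_bigr (fun=> 1)) ?sumr_const ?natz // => a aK.
  have aP : a \in P by move: aK; rewrite inE => /andP[].
  case/extendP: zs => u [c [us cK ->]].
  have /(subsetP (kspan_Kset aK)) : u \in kspan e s by [].
  rewrite kera_beta => /forallP /(_ x) /eqP bu.
  by rewrite betaDr [beta a x u]beta_sym // bu beta_alt // addr0 psi0.
have := @sum_Kset_eq0 s [:: (x, z)]; under eq_bigr do rewrite big_seq1.
apply=> l ls; apply/exists_inP; apply: contraNT zs; rewrite negb_exists_in.
move/forall_inP => triv; rewrite -ls; apply: trivial_pairs_kspan.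
- by rewrite -(size_map fst) -/(unzip1 l) ls.
- by rewrite ls.
by move=> a aP; have := triv a aP; rewrite negbK big_seq1 => /eqP.
Qed.

Notation qQ := (q%:R : rat).
Notation Y := (#|L|%:R : rat).

Lemma Y_neq0 : Y != 0.
Proof. by rewrite pnatr_eq0 -lt0n cardL expn_gt0. Qed.

(** The product counts the extensions of [s] by [u] further independent vectors of the kernel.
    Exchanging sums and peeling off the first vector reduces to [card_Kset_cons]. *)
Lemma moment_Kset u s : (size s + u < k)%N -> kfree e s ->
  \sum_(a in Kset s) \prod_(i < u) ((#|kera a|)%:R - qQ ^+ (size s + i)) =
  (#|Kset s|)%:R * \prod_(i < u) ((Y - qQ ^+ (size s + i)) * qQ ^+ (size s + i).+1 / Y).
Proof.
elim: u s => [|u IH] s su fs.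
  rewrite big_ord0 mulr1; under eq_bigr do rewrite big_ord0.
  by rewrite sumr_const.
pose F a : rat := \prod_(i < u) ((#|kera a|)%:R - qQ ^+ ((size s).+1 + i)).
pose C : rat := \prod_(i < u) ((Y - qQ ^+ ((size s).+1 + i)) * qQ ^+ ((size s).+1 + i).+1 / Y).
transitivity (\sum_(a in Kset s) \sum_(x | x \notin kspan e s)
    if x \in kera a then F a else 0).
  apply: eq_bigr => a aK; rewrite big_ord_recl addn0 -big_mkcondr sumr_const.
  have -> : \prod_(i < u) ((#|kera a|)%:R - qQ ^+ (size s + lift ord0 i)) = F a.
    by apply: eq_bigr => i _; rewrite lift0 addnS.
  rewrite -[F a *+ _]mulr_natl -natrX -(card_kspan cardL e_gt0 e_dvdm fs); congr (_ * _).
  rewrite -natrB ?subset_leq_card ?kspan_Kset //; congr (_%:R).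
  rewrite -[in LHS](setIidPr (kspan_Kset aK)) -cardsD; apply: eq_card => x.
  by rewrite in_setD [RHS]inE.
rewrite exchange_big /=.
transitivity (\sum_(x | x \notin kspan e s)
   ((#|Kset s|)%:R * (qQ ^+ (size s).+1 / Y) * C)).
  apply: eq_bigr => x xs; have fxs : kfree e (x :: s) by rewrite /= xs.
  rewrite -big_mkcondr.
  have -> : (#|Kset s|)%:R * (qQ ^+ (size s).+1 / Y) = (#|Kset (x :: s)|)%:R :> rat.
    apply: (mulIf Y_neq0); rewrite -natrM card_Kset_cons //; last by lia.
    by rewrite natrM [(_ ^ (size s).+1)%:R]natrX; field; apply: Y_neq0.
  rewrite -(IH (x :: s)) //; last by move: su => /=; lia.
  by apply: eq_bigl => a; rewrite Kset_cons.
rewrite sumr_const big_ord_recl addn0.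
have -> : \prod_(i < u) ((Y - qQ ^+ (size s + lift ord0 i)) *
    qQ ^+ (size s + lift ord0 i).+1 / Y) = C.
  by apply: eq_bigr => i _; rewrite lift0 addnS.
have -> : #|[pred x | x \notin kspan e s]| = (#|L| - q ^ size s)%N.
  rewrite -(card_kspan cardL e_gt0 e_dvdm fs) -[kspan e s in RHS]setCK -cardsCs.
  by apply: eq_card => x; rewrite in_setC [LHS]inE.
rewrite -[LHS]mulr_natl natrB; first by rewrite [(_ ^ size s)%:R]natrX; ring.
by rewrite -(card_kspan cardL e_gt0 e_dvdm fs) max_card.
Qed.

(** * Possible kernel sizes *)

Lemma card_L_q : #|L| = (q ^ (2 * N))%N.
Proof. by rewrite cardL -expnM mulnCA [(e * _)%N]mulnC divnK ?e_dvdn // -mE. Qed.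

Lemma betaZ a c x y : c \in K -> beta a (c * x) y = beta a x (c * y).
Proof. by move=> cK; rewrite /beta LaZ // mulrCA mulrA. Qed.

(* A maximal totally isotropic subspace equals its own orthogonal. *)
Lemma self_orthogonal_subspace a : a \in P ->
  exists2 U : {set L}, ksub e U & forall x, (x \in U) = [forall u in U, beta a x u == 0].
Proof.
move=> aP.
pose iso (U : {set L}) := ksub e U /\ {in U &, forall x y, beta a x y = 0}.
suff H n0 (U : {set L}) : (#|L| - #|U| < n0)%N -> iso U ->
    exists2 U : {set L}, ksub e U & forall x, (x \in U) = [forall u in U, beta a x u == 0].
  apply: (H _ [set 0] (ltnSn _)); split; first exact: (ksub_kspan e cardL [::]).
  by move=> x y; rewrite !inE => _ /eqP->; rewrite /beta mul0r frob_trace0.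
elim: n0 U => // n0 IH U lt [kU isoU].
have [/exists_inP[x /forall_inP xU xnU]|] :=
    boolP [exists x in [pred x | [forall u in U, beta a x u == 0]], x \notin U].
  (* A vector orthogonal to [U] but outside it can be adjoined without losing isotropy, because
     [beta] alternates over [K]. *)
  have xuc u c : u \in U -> c \in K -> beta a (c * x) u = 0.
    by move=> uU cK; rewrite betaZ //; apply/eqP/xU/(ksubZ kU).
  apply: (IH (extend e x U)).
    have : (#|U| < #|extend e x U|)%N.
      rewrite (card_extend cardL e_gt0 e_dvdm kU xnU).
      rewrite -[X in (X < _)%N]muln1 ltn_mul2l -{2}(expn0 2) ltn_exp2l // e_gt0 andbT.
      by apply/card_gt0P; exists 0; case: kU.
    have : (#|extend e x U| <= #|L|)%N by exact: max_card.
    by move: lt; lia.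
  split; first exact: (ksub_extend cardL).
  move=> y z /extendP[u [c [uU cK ->]]] /extendP[v [b [vU bK ->]]].
  rewrite betaDl !betaDr isoU // xuc // [beta a u _]beta_sym // xuc // betaZ //.
  by rewrite mulrA beta_alt ?fixfM // !add0r.
rewrite negb_exists_in => /forall_inP Umax; exists U => // x; apply/idP/forall_inP.
  by move=> xU u uU; apply/eqP/isoU.
by move=> H; have := Umax x; rewrite negbK; apply; apply/forall_inP.
Qed.

(** For a self-orthogonal [U] of dimension t, which contains the kernel, [card_orthogonal] reads 2t
    = 2N + dim ker. *)
Lemma card_kera_even a : a \in P -> exists j, #|kera a| = (q ^ (2 * j))%N.
Proof.
move=> aP; have [U kU Uperp] := self_orthogonal_subspace aP.
have [t tE] := card_ksub cardL e_gt0 e_dvdm kU.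
have [w wE] := card_ksub cardL e_gt0 e_dvdm (ksub_kera a).
have := @card_orthogonal _ _ cardL U (beta a) (fun x y => @ksubD _ _ _ x y kU)
  (betaDr a) (betaDl a) (beta_bool a).
have -> : [set z | [forall u in U, beta a z u == 0]] = U.
  by apply/setP => x; rewrite inE -Uperp.
have -> : [set u in U | [forall z, beta a z u == 0]] = kera a.
  apply/setP => x; rewrite inE kera_beta.
  have -> : [forall z, beta a z x == 0] = [forall z, beta a x z == 0].
    by apply: eq_forallb => z; rewrite beta_sym.
  case: forallP => [b0|_]; rewrite ?andbF // andbT Uperp.
  by apply/forall_inP => u _; apply: b0.
rewrite tE wE card_L_q -!expnD => /eqP; rewrite eqn_exp2l; last first.
  by rewrite -(expn0 2) ltn_exp2l // e_gt0.
by move=> /eqP tw; exists (t - N)%N; congr (_ ^ _)%N; lia.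
Qed.

(** Up to the injective map [sg (N - k.-1)], the operator is a polynomial of degree 2(k - 1) in
    sigma, whose fixed field is [K]. *)
Lemma card_kera_le a i0 : (i0 < k)%N -> a (inord i0) != 0 ->
  (#|kera a| <= q ^ (2 * k.-1))%N.
Proof.
move=> i0k ai0.
(* Index i stands for sigma^(N - k + 1 + i): the middle index k - 1 carries [a_0], smaller ones the
   other [a_j], larger ones their Frobenius images. *)
pose c i := if (i <= k.-1)%N then a (inord (k.-1 - i))
  else sg (N + (i - k.-1)) (a (inord (i - k.-1))).
have LaE x : La a x = \sum_(i < (2 * k.-1).+1) c i * fr (i * d) (sg (N - k.-1) x).
  have cE i : c i * fr (i * d) (sg (N - k.-1) x) = c i * sg (i + (N - k.-1)) x.
    by rewrite frA mulnDl.
  under eq_bigr do rewrite cE.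
  rewrite -(big_mkord xpredT (fun i => c i * sg (i + (N - k.-1)) x)).
  rewrite (@big_cat_nat _ _ _ k.-1.+1) //=; last by lia.
  rewrite big_nat_recr //= {2}/c leqnn subnn.
  have -> : inord 0 = ord0 :> 'I_k.+1 by apply: val_inj; rewrite /= inordK.
  rewrite subnKC; last by lia.
  rewrite /La big_split addrCA addrA /=; congr (_ + _ + _).
    rewrite big_add1 big_nat_rev; apply: eq_big_nat => i ik.
    rewrite /c ifT; last by lia.
    by congr (a (inord _) * sg _ x); lia.
  rewrite -[k.-1.+1]add1n big_addn; have -> : ((2 * k.-1).+1 - k.-1 = k)%N by lia.
  apply: eq_big_nat => j jk; rewrite frM /c ifF ?addnK; last by lia.
  by congr (_ * sg _ x); lia.
have inj : injective (sg (N - k.-1)) by apply: fr_inj.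
have -> : kera a = sg (N - k.-1) @^-1:
    [set y | \sum_(i < (2 * k.-1).+1) c i * fr (i * d) y == 0].
  by apply/setP => x; rewrite !inE LaE.
rewrite (card_preimset _ inj) -(card_fixf cardL e_gt0 e_dvdm).
rewrite [in fixf L e]eEm -fixf_gcd //.
apply: (@card_ker_fpoly _ charL _ _ _ (k.-1 - i0)%N); first by lia.
rewrite /c ifT; last by lia.
by have -> : (k.-1 - (k.-1 - i0) = i0)%N by lia.
Qed.

(** * Exponential sums and their averages *)

Definition expsum a : int := \sum_x psi (fa a x).

Lemma psi_sqr x : psi x * psi x = 1.
Proof. by rewrite /psi; case: (x != 0). Qed.

(** In the square, substituting x + y produces [psi (beta a x y)], whose sum over x confines y to
    the kernel. There [fa a] is additive, so what remains is 0 or the kernel size. *)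
Lemma expsum_sqr a : a \in P ->
  expsum a = 0 \/ expsum a ^+ 2 = (#|L| * #|kera a|)%:Z.
Proof.
move=> aP.
have sqE : expsum a ^+ 2 = #|L|%:Z * \sum_(y in kera a) psi (fa a y).
  rewrite expr2 {1}/expsum mulr_suml.
  rewrite (eq_bigr (fun x => \sum_y psi (fa a y) * psi (beta a x y))); last first.
    move=> x _; rewrite /expsum mulr_sumr (reindex_inj (addrI x)) /=.
    apply: eq_bigr => y _; rewrite faD // !psiD ?boolD ?fa_bool ?beta_bool //.
    by rewrite !mulrA psi_sqr mul1r.
  rewrite exchange_big mulr_sumr [RHS]big_mkcond; apply: eq_bigr => y _ /=.
  rewrite -mulr_sumr (eq_bigr (fun x => psi (beta a y x))).
    by rewrite sum_psi_beta; case: ifP => _; rewrite ?mulr0 // mulrC.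
  by move=> x _; rewrite beta_sym.
have opK x : involutive (+%R x) by move=> y; rewrite addrA addrr2 // add0r.
have faDk x y : x \in kera a -> y \in kera a -> fa a (x + y) = fa a x + fa a y.
  by rewrite kera_beta => /forallP/(_ y)/eqP b0 _; rewrite faD // b0 addr0.
have := sum_psi_group charL opK (fun x y => @ksubD _ _ _ x y (ksub_kera a)) faDk
  (fun x _ => fa_bool x aP).
case: ifP => _ H; [right | left]; move: sqE; rewrite H ?mulr0.
  by rewrite PoszM.
by move/eqP; rewrite sqrf_eq0 => /eqP.
Qed.

Definition shift (c : L) : {ffun 'I_k.+1 -> L} :=
  [ffun i => if i == inord k then c else 0].

Lemma ord0_inord i : (0 < i <= k)%N -> (ord0 == inord i :> 'I_k.+1) = false.
Proof. by move=> ik; apply/eqP => /(congr1 val) /=; rewrite inordK; lia. Qed.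

Lemma shift_inord c j : (j < k)%N -> shift c (inord j) = 0.
Proof. by move=> jk; rewrite ffunE inord_eq ?(ltn_eqF jk) // ltnW. Qed.

Lemma shift_ord0 c : shift c ord0 = 0.
Proof. by rewrite ffunE ord0_inord // k_gt0 leqnn. Qed.

Lemma shiftP c : shift c \in P.
Proof. by apply/paramP; rewrite shift_ord0 fr0. Qed.

Lemma La_shift c x : La (shift c) x = 0.
Proof.
rewrite /La shift_ord0 mul0r add0r big_nat big1 // => j /andP[_ jk].
by rewrite shift_inord // !mul0r fr0 addr0.
Qed.

Lemma fa_shift c x : fa (shift c) x = Tr (c * x).
Proof.
rewrite faE shift_ord0 mul0r frob_trace0 // add0r ffunE eqxx.
rewrite big_nat big1 ?add0r // => j /andP[_ jk].
by rewrite shift_inord // mul0r frob_trace0.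
Qed.

Lemma kera_shift a c : kera (a + shift c) = kera a.
Proof. by apply/setP => x; rewrite !inE LaDa La_shift addr0. Qed.

Lemma sum_psi_Tr x : \sum_c psi (Tr (c * x)) = if x == 0 then #|L|%:Z else 0.
Proof.
have := @sum_psi _ _ cardL setT (fun c => Tr (c * x)) (fun _ _ _ _ => in_setT _).
rewrite cardsT; under eq_bigl do rewrite inE; move=> ->; last 2 first.
- by move=> c b; rewrite mulrDl frob_traceD.
- by move=> c; apply: Tr_bool.
congr (if _ then _ else _); apply/forall_inP/eqP => [T0|-> c _].
  by apply: (Tr_nondeg cardL) => c; apply/eqP/T0.
by rewrite mulr0 frob_trace0.
Qed.

Lemma psi_shift a c x : a \in P ->
  psi (fa (a + shift c) x) = psi (fa a x) * psi (Tr (c * x)).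
Proof. by move=> aP; rewrite faDa fa_shift psiD ?fa_bool ?Tr_bool. Qed.

(** Summing over [c] first kills every x except 0. *)
Lemma sum_expsum_shift a : a \in P -> \sum_c expsum (a + shift c) = #|L|%:Z.
Proof.
move=> aP; rewrite exchange_big (bigD1 0) //= [X in _ + X]big1 => [|x x0].
  rewrite addr0 (eq_bigr (fun c => psi (fa a 0) * psi (Tr (c * 0)))) => [|c _].
    by rewrite -mulr_sumr sum_psi_Tr eqxx fa0 psi0 mul1r.
  exact: psi_shift.
rewrite (eq_bigr (fun c => psi (fa a x) * psi (Tr (c * x)))) => [|c _].
  by rewrite -mulr_sumr sum_psi_Tr (negPf x0) mulr0.
exact: psi_shift.
Qed.

(** Summing over [c] first leaves only the diagonal x = y. *)
Lemma sum_expsum_sqr_shift a : a \in P ->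
  \sum_c expsum (a + shift c) ^+ 2 = (#|L| * #|L|)%:Z.
Proof.
move=> aP.
have E c : expsum (a + shift c) ^+ 2 =
    \sum_x \sum_y psi (fa a x) * psi (fa a y) * psi (Tr (c * (x + y))).
  rewrite expr2 {1}/expsum mulr_suml; apply: eq_bigr => x _.
  rewrite /expsum mulr_sumr; apply: eq_bigr => y _.
  by rewrite !psi_shift // mulrDr frob_traceD // psiD ?Tr_bool // mulrACA.
rewrite (eq_bigr _ (fun c _ => E c)) exchange_big /=.
rewrite (eq_bigr (fun=> #|L|%:Z)) => [|x _].
  by rewrite sumr_const cardT -cardE -mulr_natr natz PoszM.
rewrite exchange_big (bigD1 x) //= [X in _ + X]big1 => [|y yx].
  by rewrite -mulr_sumr sum_psi_Tr addrr2 // eqxx psi_sqr mul1r addr0.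
rewrite -mulr_sumr sum_psi_Tr addr_eq0_2 // eq_sym (negPf yx) mulr0 //.
Qed.

(* Averaging over the linear coefficient [a_k], on which the kernel does not depend. *)
Lemma sum_shift_average (A : pred {ffun 'I_k.+1 -> L})
    (f : {ffun 'I_k.+1 -> L} -> int) (v : int) :
  (forall a c, A (a + shift c) = A a) ->
  (forall a, A a -> \sum_c f (a + shift c) = v) ->
  #|L|%:Z * \sum_(a | A a) f a = v *+ #|A|.
Proof.
move=> As fs; rewrite -sumr_const -(eq_bigr _ fs) exchange_big /=.
rewrite -[#|L|%:Z]natz mulr_natl -sumr_const; apply: eq_bigr => c _.
rewrite (reindex_inj (addIr (shift c))) /=.
by apply: eq_bigl => a; rewrite As.
Qed.

Lemma card_param : #|P| = (2 ^ n * #|L| ^ k)%N.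
Proof.
pose F (i : 'I_k.+1) : pred L := [pred x | (i == ord0) ==> (x \in fixf L n)].
have -> : #|P| = #|family F|.
  apply: eq_card => a; apply/paramP/familyP => [a0 i|/(_ ord0)].
    by rewrite !inE; apply/implyP => /eqP->; apply/eqP.
  by rewrite !inE => /eqP.
rewrite card_family foldrE big_map big_enum big_ord_recl /=.
rewrite (eq_bigr (fun=> #|L|)) => [|i _]; last by apply: eq_card => x; rewrite !inE.
rewrite prod_nat_const card_ord -(card_fixf cardL n_gt0) ?mE ?dvdn_mull //.
Qed.

(** The degenerate parameters, for which [fa a] is linear and the kernel is all of [L]. *)
Definition shifts : {set {ffun 'I_k.+1 -> L}} := [set shift c | c in L].

Lemma card_shifts : #|shifts| = #|L|.
Proof.
rewrite card_imset // => c c' /ffunP/(_ (inord k)).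
by rewrite !ffunE eqxx.
Qed.

Lemma shiftsP a : a \notin shifts -> exists2 j, (j < k)%N & a (inord j) != 0.
Proof.
move=> aS; have [/existsP[j aj]|] := boolP [exists j : 'I_k, a (inord j) != 0].
  by exists j.
rewrite negb_exists => /forallP a0; case/imsetP: aS; exists (a (inord k)) => //.
apply/ffunP => i; rewrite ffunE; have [->//|ik] := eqVneq i (inord k).
have ik' : (i < k)%N.
  rewrite ltn_neqAle -ltnS ltn_ord andbT; apply: contraNneq ik => ik.
  by apply/eqP/val_inj; rewrite /= inordK.
by have := a0 (Ordinal ik'); rewrite negbK /= inord_val => /eqP.
Qed.

Lemma kera_shifts a : a \in shifts -> kera a = setT.
Proof. by case/imsetP => c _ ->; apply/setP => x; rewrite !inE La_shift eqxx. Qed.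

(** * The number of parameters with a given kernel size *)

Definition layer j := [set a in P | #|kera a| == q ^ (2 * j)]%N.

Lemma q_gt1 : (1 < q)%N. Proof. by rewrite -(expn0 2) ltn_exp2l // e_gt0. Qed.

Lemma layer_shifts j a : (j < k)%N -> a \in layer j -> a \notin shifts.
Proof.
move=> jk; rewrite inE => /andP[_ /eqP Xa]; apply/negP => /kera_shifts ka.
move: Xa; rewrite ka cardsT card_L_q => /eqP; rewrite eqn_exp2l ?q_gt1 //.
by apply/negP; lia.
Qed.

Lemma layer_exists a : a \in P -> a \notin shifts ->
  exists2 j, (j < k)%N & a \in layer j.
Proof.
move=> aP /shiftsP[i ik ai]; have [j Xa] := card_kera_even aP.
exists j; last by rewrite inE aP Xa eqxx.
by have := card_kera_le ik ai; rewrite Xa leq_exp2l ?q_gt1 //; lia.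
Qed.

(** Outside [shifts], which account for the term in |L|, each parameter lies in exactly one layer of
    index below [k]. *)
Lemma sum_kera (f : nat -> rat) :
  \sum_(a in P) f #|kera a| =
  (#|L|)%:R * f #|L| + \sum_(i < k) (#|layer i|)%:R * f (q ^ (2 * i))%N.
Proof.
have SP : shifts \subset P by apply/subsetP => a /imsetP[c _ ->]; apply: shiftP.
rewrite (big_setID shifts) /= (setIidPr SP); congr (_ + _).
  rewrite (eq_bigr (fun=> f #|L|)) => [|a aS]; last by rewrite kera_shifts ?cardsT.
  by rewrite sumr_const card_shifts mulr_natl.
have laysub i : (i < k)%N -> layer i \subset P :\: shifts.
  move=> ik; apply/subsetP => a ai; rewrite inE (layer_shifts ik ai) /=.
  by move: ai; rewrite inE => /andP[].
transitivity (\sum_(a in P :\: shifts) \sum_(i < k)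
    if a \in layer i then f (q ^ (2 * i))%N else 0).
  apply: eq_bigr => a; rewrite inE => /andP[aS aP].
  have [j jk aj] := layer_exists aP aS.
  move: (aj); rewrite inE => /andP[_ /eqP Xa].
  rewrite (bigD1 (Ordinal jk)) //= aj Xa big1 ?addr0 // => i ij.
  case: ifP => //; rewrite inE Xa => /andP[_]; rewrite eqn_exp2l ?q_gt1 // => ji.
  by case/eqP: ij; apply: val_inj => /=; lia.
rewrite exchange_big; apply: eq_bigr => i _.
rewrite -big_mkcondr sumr_const -[LHS]mulr_natl; congr (_%:R * _).
apply: eq_card => a; apply/andP/idP => [[_ ai]//|ai].
by split=> //; apply: (subsetP (laysub i (ltn_ord i))).
Qed.

Lemma moment_param u : (u < k)%N ->
  \sum_(a in P) \prod_(i < u) ((#|kera a|)%:R - qQ ^+ i) =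
  (#|P|)%:R * \prod_(i < u) ((Y - qQ ^+ i) * qQ ^+ i.+1 / Y).
Proof.
move=> uk; have := @moment_Kset u [::] uk isT.
have -> : Kset [::] = P by apply/setP => a; rewrite KsetE andbT.
by [].
Qed.

Notation b := (4 ^ e)%N.

Lemma exp4_gt1 : (1 < b)%N. Proof. by rewrite -(expn0 4) ltn_exp2l // e_gt0. Qed.

Lemma exp4X i : (b%:R : rat) ^+ i = qQ ^+ (2 * i).
Proof. by rewrite exprM; congr (_ ^+ _); rewrite -!natrX -expnM mulnC expnM. Qed.

Lemma card_LE : Y = qQ ^+ (2 * N).
Proof. by rewrite card_L_q natrX. Qed.

Lemma prod_gbinom i v :
  \prod_(t < v) (qQ ^+ (2 * i) - qQ ^+ (2 * t)) = gden b v * gbinom b i v.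
Proof.
rewrite gbinomE ?exp4_gt1 // mulrC divfK ?gden_neq0 ?exp4_gt1 //.
by apply: eq_bigr => t _; rewrite !exp4X.
Qed.

(** This is [qmoment] for the kernel sizes, in base q^2 = 4^e. The contribution of [shifts], moved
    to the right, becomes the final -1. *)
Lemma layer_moment v : (v < k)%N ->
  \sum_(i < k) (#|layer i|)%:R / Y * gbinom b i v =
  gbinom b N v * (qQ ^+ (N * (2 * k - 1 - 2 * v) + v) - 1).
Proof.
move=> vk; have vk1 : (v <= k.-1)%N by lia.
have mom u : (u <= k.-1)%N -> \sum_(a in P) \prod_(i < u) ((#|kera a|)%:R - qQ ^+ i) =
  (#|P|)%:R * \prod_(i < u) ((Y - qQ ^+ i) * qQ ^+ i.+1 / Y).
  by move=> uk; apply: moment_param; lia.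
have := qmoment Y_neq0 mom vk1.
rewrite (sum_kera (fun X => \prod_(i < v) (X%:R - qQ ^+ (2 * i)))).
have PY : \prod_(t < v) (Y - qQ ^+ (2 * t)) = gden b v * gbinom b N v.
  by rewrite -prod_gbinom card_LE.
rewrite /= PY.
rewrite (eq_bigr (fun i : 'I_k => (#|layer i|)%:R * (gden b v * gbinom b i v))).
  move=> H; apply: (mulfI (gden_neq0 exp4_gt1 v)); apply: (mulfI Y_neq0).
  transitivity (\sum_(i < k) (#|layer i|)%:R * (gden b v * gbinom b i v)).
    by rewrite !mulr_sumr; apply: eq_bigr => i _; field; apply: Y_neq0.
  apply: (addrI (Y * (gden b v * gbinom b N v))); rewrite H.
  have -> : (#|P|)%:R = qQ ^+ N * Y ^+ k.
    rewrite card_param natrM [(#|L| ^ k)%:R]natrX; congr (_ * _).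
    by rewrite -natrX -expnM mulnC divnK ?e_dvdn.
  (* With Y = q^(2N) both exponents equal N + 2Nk + v once Y^v is cleared; the truncated
     subtractions are exact because v < k. *)
  have EY : qQ ^+ N * Y ^+ k * (qQ / Y) ^+ v = Y * qQ ^+ (N * (2 * k - 1 - 2 * v) + v).
    rewrite expr_div_n mulrA; apply: (canLR (mulfK _)).
      by rewrite expf_neq0 ?Y_neq0.
    by rewrite card_LE -!exprM -!exprD; congr (_ ^+ _); nia.
  by rewrite EY; ring.
move=> i _; rewrite -prod_gbinom; congr (_ * _); apply: eq_bigr => t _.
by rewrite [(_ ^ (2 * i))%:R]natrX.
Qed.

Lemma card_layer j : (j < k)%N ->
  (#|layer j|)%:R / Y = \sum_(j <= v < k)
    (-1) ^+ (v - j) * b%:R ^+ 'C(v - j, 2) * gbinom b v j *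
    (gbinom b N v * (qQ ^+ (N * (2 * k - 1 - 2 * v) + v) - 1)).
Proof.
exact: (gbinom_inversion exp4_gt1 (A := fun i => (#|layer i|)%:R / Y)
  (B := fun v => gbinom b N v * (qQ ^+ (N * (2 * k - 1 - 2 * v) + v) - 1))
  layer_moment).
Qed.

Lemma layer_shift j a c : (a + shift c \in layer j) = (a \in layer j).
Proof.
rewrite [LHS]inE [RHS]inE kera_shift; congr (_ && _).
apply/idP/idP => [aP|aP]; last exact: paramD (shiftP c).
by have := paramD aP (shiftP c); rewrite -addrA ffun_addrr2 addr0.
Qed.

Lemma sum_expsum_layer j : \sum_(a in layer j) expsum a = #|layer j|%:Z.
Proof.
have L0 : #|L|%:Z != 0 by rewrite cardL -lt0n expn_gt0.
apply: (mulfI L0); rewrite (@sum_shift_average _ _ #|L|%:Z) ?mulr_natr ?natz //.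
- by rewrite -mulr_natr natz.
- by move=> a c; apply: layer_shift.
by move=> a; rewrite inE => /andP[aP _]; apply: sum_expsum_shift.
Qed.

Lemma sum_expsum_sqr_layer j :
  \sum_(a in layer j) expsum a ^+ 2 = (#|layer j| * #|L|)%:Z.
Proof.
have L0 : #|L|%:Z != 0 by rewrite cardL -lt0n expn_gt0.
apply: (mulfI L0).
rewrite (@sum_shift_average _ (fun a => expsum a ^+ 2) (#|L| * #|L|)%:Z).
- by rewrite -mulr_natr natz -!PoszM; congr Posz; ring.
- by move=> a c; apply: layer_shift.
by move=> a; rewrite inE => /andP[aP _]; apply: sum_expsum_sqr_shift.
Qed.

(** On the layer the sum S is 0 or plus or minus s = 2^(n + ej), so (S^2/s^2 + eps S/s)/2 is the
    indicator of S = eps s; the first two moments of S over the layer are known. *)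
Lemma card_expsum_eq j (eps : int) : eps = 1 \/ eps = -1 ->
  (#|[set a in P | expsum a == eps * 2%:Z ^+ (n + e * j)]|)%:R =
  (#|layer j|)%:R * (Y / 2%:R ^+ (2 * (n + e * j)) + eps%:~R / 2%:R ^+ (n + e * j)) / 2
  :> rat.
Proof.
move=> epsP; set s := 2%:Z ^+ (n + e * j); pose sQ : rat := s%:~R.
have s0 : s != 0 by rewrite expf_neq0.
have sQ0 : sQ != 0 by rewrite intr_eq0.
have sQE : 2%:R ^+ (n + e * j) = sQ by rewrite /sQ rmorphXn.
have s2 : s ^+ 2 = (#|L| * q ^ (2 * j))%:Z.
  rewrite /s -exprM cardL -expnM -expnD -[RHS]natz natrX natz.
  by rewrite mE; congr (_ ^+ _); lia.
have eps2 : eps ^+ 2 = 1 by case: epsP => ->.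
have L0 : #|L|%:Z != 0 by rewrite cardL -lt0n expn_gt0.
(* The value eps s determines the kernel size through [expsum_sqr], so all these parameters lie in
   the layer. *)
transitivity (\sum_(a in layer j) ((expsum a == eps * s)%:R : rat)).
  rewrite -sum1_card natr_sum [RHS]big_mkcond [LHS]big_mkcond; apply: eq_bigr => a _.
  rewrite [a \in [set _ | _]]inE [a \in layer j]inE.
  case aP : (a \in P) => //=; case: eqP => [Sa|]; last by case: ifP.
  rewrite ifT //; apply/eqP.
  have S2 : expsum a ^+ 2 = (#|L| * q ^ (2 * j))%:Z by rewrite Sa exprMn eps2 mul1r s2.
  have [S0|] := expsum_sqr aP.
    by move: Sa; rewrite S0 => /esym/eqP; rewrite mulf_eq0 (negPf s0) orbF; case: epsP => ->.
  by rewrite S2 !PoszM => /(mulfI L0) [].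
transitivity (\sum_(a in layer j)
   (((expsum a ^+ 2)%:~R / sQ ^+ 2 + eps%:~R * (expsum a)%:~R / sQ) / 2) : rat).
  apply: eq_bigr => a; rewrite inE => /andP[aP /eqP Xa].
  have [S0|] := expsum_sqr aP.
    have -> : (expsum a == eps * s) = false.
      by rewrite S0 eq_sym mulf_eq0 (negPf s0) orbF; case: epsP => ->.
    by rewrite S0 expr0n /= mulr0z mulr0 !mul0r.
  rewrite Xa -s2 => /eqP; rewrite eqf_sqr => /orP[]/eqP->.
    rewrite rmorphXn /= -/sQ; case: epsP => ->.
      by rewrite mul1r eqxx mulr1z -[true%:R]/(1 : rat); field.
    have -> : (s == -1 * s) = false.
      by rewrite mulN1r -subr_eq0 opprK -mulr2n mulrn_eq0 (negPf s0).
    by rewrite rmorphN1 -[false%:R]/(0 : rat); field.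
  rewrite sqrrN rmorphXn rmorphN /= -/sQ; case: epsP => ->.
    have -> : (- s == 1 * s) = false.
      by rewrite mul1r eq_sym -subr_eq0 opprK -mulr2n mulrn_eq0 (negPf s0).
    by rewrite mulr1z -[false%:R]/(0 : rat); field.
  by rewrite mulN1r eqxx rmorphN1 -[true%:R]/(1 : rat); field.
rewrite -mulr_suml big_split /= -!mulr_suml -mulr_sumr -!rmorph_sum /=.
rewrite sum_expsum_layer sum_expsum_sqr_layer -!pmulrn natrM.
by rewrite [in RHS]mulnC exprM sQE; field.
Qed.

(** * Passage from parameters to codewords *)

Section Code.
Variable pi : L.
Hypothesis prim_pi : (2 ^ m - 1).-primitive_root pi.

Lemma inj_pi : injective (fun i : 'I_(2 ^ m - 1) => pi ^- i).
Proof.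
move=> i j /invr_inj /eqP.
by rewrite (eq_prim_root_expr prim_pi) !modn_small ?ltn_ord // => /eqP/val_inj.
Qed.

Lemma imset_pi : [set pi ^- (i : 'I_(2 ^ m - 1)) | i in 'I_(2 ^ m - 1)] = [set~ 0].
Proof.
have pi0 : pi != 0.
  apply: contraTneq prim_pi => ->; apply/negP => /prim_expr_order/eqP.
  by rewrite expr0n (negPf (lt0n_neq0 (prim_order_gt0 prim_pi))) eq_sym oner_eq0.
apply/eqP; rewrite eqEcard; apply/andP; split.
  by apply/subsetP => x /imsetP[i _ ->]; rewrite !inE invr_eq0 expf_eq0 (negPf pi0) andbF.
by rewrite cardsC1 cardL (card_imset _ inj_pi) card_ord subn1.
Qed.

Lemma codewordE a i : codeword m n d e pi a i = (fa a (pi ^- i) != 0).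
Proof. by rewrite ffunE. Qed.

(** The points [pi ^- i] run over the nonzero elements, and the missing x = 0 contributes 1. *)
Lemma DC_codeword a : DC (codeword m n d e pi a) = expsum a - 1.
Proof.
rewrite /expsum (bigD1 0) //= fa0 psi0 addrC addrK.
rewrite (eq_bigl (fun x => x \in [set~ 0])) => [|x]; last by rewrite !inE.
rewrite -imset_pi big_imset /=; last by move=> i j _ _ /inj_pi.
by apply: eq_bigr => i _; rewrite codewordE.
Qed.

(** Equal words make [fa (a + b)] vanish identically, so [expsum (a + b)] is |L| and the kernel is
    everything. Thus [a + b] is some [shift c], and nondegeneracy of the trace forces c = 0. *)
Lemma codeword_inj : {in P &, injective (codeword m n d e (k := k) pi)}.
Proof.
move=> a b aP bP ab.
have fab x : fa (a + b) x = 0.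
  have [->|x0] := eqVneq x 0; first by rewrite fa0.
  have : x \in [set~ 0] by rewrite !inE.
  rewrite -imset_pi => /imsetP[i _ ->]; rewrite faDa.
  move/ffunP/(_ i): ab; rewrite !codewordE.
  case/orP: (fa_bool (pi ^- i) aP) => /eqP->; case/orP: (fa_bool (pi ^- i) bP) => /eqP->;
    by rewrite ?eqxx ?oner_eq0 ?addr0 ?addrr2.
have SL : expsum (a + b) = #|L|%:Z.
  rewrite /expsum (eq_bigr (fun=> 1)) => [|x _]; last by rewrite fab psi0.
  by rewrite sumr_const natz.
have L0 : #|L|%:Z != 0 by rewrite cardL -lt0n expn_gt0.
have kerL : kera (a + b) = setT.
  apply/eqP; rewrite eqEcard subsetT cardsT.
  have [S0|] := expsum_sqr (paramD aP bP); first by rewrite -SL S0 eqxx in L0.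
  rewrite SL expr2 PoszM => /(mulfI L0) [kL].
  by rewrite -kL leqnn.
have abS : a + b \in shifts.
  apply: contraT => /(layer_exists (paramD aP bP))[j jk].
  rewrite inE kerL cardsT card_L_q eqn_exp2l ?q_gt1 // => /andP[_]; lia.
case/imsetP: abS => c _ abc; suff c0 : c = 0.
  apply/ffunP => i; apply/eqP; rewrite -addr_eq0_2 //.
  by move/ffunP/(_ i): abc; rewrite !ffunE c0 if_same => ->.
apply: (Tr_nondeg cardL) => x.
by rewrite mulrC -fa_shift -abc fab.
Qed.

Lemma alpha_layer j (eps : int) : (j < k)%N -> eps = 1 \/ eps = -1 ->
  alpha m n d e k pi (m %/ e - 2 * j) eps =
  #|[set a in P | expsum a == eps * 2%:Z ^+ (n + e * j)]|.
Proof.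
move=> jk epsP.
have eN : (e * N = n)%N by rewrite mulnC divnK ?e_dvdn.
have expE : (m - (e * (m %/ e - 2 * j)) %/ 2 = n + e * j)%N.
  have -> : (e * (m %/ e - 2 * j) = (n - e * j) * 2)%N 
    by rewrite m_div_e -mulnBr mulnCA mulnBr eN mulnC.
  have ejn : (e * j <= n)%N by rewrite -[X in (_ <= X)%N]eN leq_mul2l; apply/orP; right; lia.
  by rewrite mulnK // mE; lia.
have inj : {in [set a in P | expsum a == eps * 2%:Z ^+ (n + e * j)] &,
    injective (codeword m n d e (k := k) pi)}.
  by apply: sub_in2 codeword_inj => a; rewrite inE => /andP[].
rewrite -(card_in_imset inj) /alpha expE; apply: eq_card => w; rewrite inE.
apply/andP/imsetP => [[/imsetP[a aP ->] /andP[_]]|[a]].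
  rewrite DC_codeword addrC => /eqP/addrI Sa; exists a => //.
  by rewrite inE aP Sa eqxx.
rewrite inE => /andP[aP /eqP Sa] ->; split; first by apply/imsetP; exists a.
(* The zero word would require eps 2^(n + ej) = 2^m, but n + ej < m since j < k <= N. *)
rewrite DC_codeword Sa addrC eqxx andbT; apply/eqP => c0.
have := DC_codeword a; rewrite c0 /DC (eq_bigr (fun=> 1)) => [|i _]; last by rewrite ffunE.
rewrite sumr_const card_ord natz Sa.
have tE : 2%:Z ^+ (n + e * j) = (2 ^ (n + e * j))%:Z by rewrite -[RHS]natz natrX natz.
have t0 : (0 < 2 ^ (n + e * j))%N by rewrite expn_gt0.
have tm : (2 ^ (n + e * j) < 2 ^ m)%N by 
  rewrite ltn_exp2l // mE mul2n -addnn ltn_add2l -[X in (_ < X)%N]eN ltn_mul2l e_gt0; lia.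
by rewrite tE; case: epsP => ->; lia.
Qed.

End Code.

End Forms.

(** * The weight distribution formula *)

Theorem theorem1p2 (L : finFieldType) (m n d e k : nat) (pi : L) :
  (0 < m)%N -> (0 < n)%N -> (0 < d)%N -> (0 < e)%N -> (0 < k)%N ->
  m = (2 * n)%N -> e = gcdn n d -> e = gcdn m d -> (1 <= k <= n %/ e)%N ->
  #|L| = (2 ^ m)%N -> (2 ^ m - 1).-primitive_root pi ->
  forall (j : nat) (eps : int), (j < k)%N -> (eps = 1 \/ eps = -1) ->
  ((alpha m n d e k pi (m %/ e - 2 * j) eps)%:R : rat) =
    (1 / 2) * (2%:R ^+ (m - 2 * e * j) + eps%:~R * 2%:R ^+ (m %/ 2 - e * j)) *
    \sum_(j <= v < k)
      ((-1) ^+ (v - j) * 4%:R ^+ (e * 'C(v - j, 2)) *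
       gbinom (4 ^ e) v j * gbinom (4 ^ e) (m %/ (2 * e)) v *
       (2%:R ^+ (n * (2 * k - 1 - 2 * v) + e * v) - 1)).
Proof.
move=> _ n_gt0 d_gt0 e_gt0 k_gt0 mE eEn eEm /andP[_ k_le] cardL prim_pi.
move=> j eps jk epsP.
rewrite (alpha_layer cardL n_gt0 d_gt0 k_gt0 mE eEn eEm k_le prim_pi jk epsP).
rewrite (card_expsum_eq cardL n_gt0 d_gt0 k_gt0 mE eEn eEm k_le) //.
have eN : (e * (n %/ e) = n)%N by rewrite mulnC divnK // eEn dvdn_gcdl.
have ejn : (e * j <= n)%N.
  by rewrite -[X in (_ <= X)%N]eN leq_mul2l; apply/orP; right; lia.
have mq : (m %/ (2 * e) = n %/ e)%N by rewrite mE divnMl.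
have m2 : (m %/ 2 = n)%N by rewrite mE mulKn.
(* The sum is that of [card_layer]; the prefactor arises from 2^(m - 2ej) = |L|^2 / 2^(2(n + ej))
   and 2^(n - ej) = |L| / 2^(n + ej). *)
transitivity (\sum_(j <= v < k)
    (-1) ^+ (v - j) * (4 ^ e)%:R ^+ 'C(v - j, 2) * gbinom (4 ^ e) v j *
    (gbinom (4 ^ e) (n %/ e) v *
      ((2 ^ e)%:R ^+ (n %/ e * (2 * k - 1 - 2 * v) + v) - 1)) *
    ((1 / 2) * (2%:R ^+ (m - 2 * e * j) + eps%:~R * 2%:R ^+ (m %/ 2 - e * j))) : rat).
  rewrite -mulr_suml -(card_layer cardL n_gt0 d_gt0 k_gt0 mE eEn eEm k_le jk).
  have t0 : 2%:R ^+ (n + e * j) != 0 :> rat by rewrite expf_neq0.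
  have Y0 : (#|L|)%:R != 0 :> rat by exact: Y_neq0 cardL.
  have -> : 2%:R ^+ (m - 2 * e * j) = (#|L|)%:R ^+ 2 / 2%:R ^+ (2 * (n + e * j)) :> rat.
    apply: (canRL (mulfK _)); first by rewrite expf_neq0.
    rewrite cardL natrX -exprM -exprD; congr (_ ^+ _); lia.
  have -> : 2%:R ^+ (m %/ 2 - e * j) = (#|L|)%:R / 2%:R ^+ (n + e * j) :> rat.
    apply: (canRL (mulfK t0)).
    rewrite cardL natrX -exprD; congr (_ ^+ _); lia.
  rewrite [(2 * (n + _))%N]mulnC exprM; field.
  by rewrite Y0 t0.
rewrite mulr_sumr; apply: eq_bigr => v _; rewrite mq.
rewrite [(4 ^ e)%:R]natrX -exprM [(2 ^ e)%:R]natrX -exprM mulnDr mulnA eN; ring.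
Qed.
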